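(* Let $f$ be a Steinhaus random multiplicative function and let $(a_n)_{n\le N}$ be complex numbers with $V=\sum_{n\le N}|a_n|^2>0$. Define $Z=\frac{1}{\sqrt V}\sum_{n\le N}a_nf(n)$. Suppose $\mathcal{S}\subset[2,N]$ is a set of integers such that for some $0<\epsilon\le 1$: (1) $\sum_{n\le N,\,n\notin\mathcal{S}}|a_n|^2\le\epsilon^2V$; (2) $\displaystyle\Big|\sum_{\substack{m_1,m_2,n_1,n_2\in\mathcal{S}\\ m_1m_2=n_1n_2\\ m_1\ne n_1,\ m_2\ne n_2\\ P(m_1)=P(n_1),\ P(m_2)=P(n_2)}}a_{m_1}a_{m_2}\overline{a_{n_1}a_{n_2}}\Big|\le\epsilon^2V^2$; (3) $\displaystyle\Big|\sum_{\substack{m_1,m_2,n_1,n_2\in\mathcal{S}\\ m_1m_2=n_1n_2\\ P(m_1)=P(n_1)=P(m_2)=P(n_2)}}a_{m_1}a_{m_2}\overline{a_{n_1}a_{n_2}}\Big|\le\epsilon^4V^2$. Then for all real $t_1,t_2$, with $t^2=(t_1^2+t_2^2)/2$, $$\mathbb{E}\big[e^{it_1\mathrm{Re}(Z)+it_2\mathrm{Im}(Z)}\big]=e^{-t^2/2}+O(e^{t^2}\epsilon),$$ with an absolute implied constant.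
   Context: A Steinhaus random multiplicative function $f$ is a completely multiplicative function whose values $f(p)$ at primes $p$ are independent random variables, each uniformly distributed on the unit circle. $P(n)$ denotes the largest prime factor of the integer $n$. *)

(* Defs.v *)
From HB Require Import structures.
From mathcomp Require Import all_boot all_order all_algebra.
From mathcomp Require Import finmap.
From mathcomp Require Import complex.
From mathcomp Require Import all_classical all_reals all_analysis.

Set Implicit Arguments.
Unset Strict Implicit.
Unset Printing Implicit Defensive.

Import Order.TTheory GRing.Theory Num.Theory.

Local Open Scope classical_set_scope.
Local Open Scope ring_scope.

(* Modulus of a complex number as an element of [R]; the generic norm on
   [R[i]] takes its values in [R[i]]. *)
Notation cabs := (@ComplexField.Normc.normc _).

Section complex_random_variables.
Context {R : realType}.

Definition expi (theta : R) : R[i] := Complex (cos theta) (sin theta).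

(* [R[i]] carries no measurable structure in the library: a complex random
   variable is handled through its image in [R * R], with the product
   sigma-algebra. *)
Definition plane (z : R[i]) : R * R := (complex.Re z, complex.Im z).

Definition cexpectation {d : measure_display} {T : measurableType d}
    (P : probability T R) (X : T -> R[i]) : R[i] :=
  Complex (fine 'E_P[fun w => complex.Re (X w)])
          (fine 'E_P[fun w => complex.Im (X w)]).

Lemma pi2_gt0 : 0 < pi *+ 2 :> R.
Proof. by rewrite mulrn_wgt0// pi_gt0. Qed.

(* The law of [X] is the image of the uniform law on [0, 2 pi] under
   [theta |-> expi theta]. *)
Definition uniform_on_circle {d : measure_display} {T : measurableType d}
    (P : probability T R) (X : T -> R[i]) : Prop :=
  forall A : set (R * R), measurable A ->
    P [set w | A (plane (X w))] =
    uniform_prob pi2_gt0 [set theta | A (plane (expi theta))].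

Definition mutually_independent {d : measure_display} {T : measurableType d}
    (P : probability T R) (I : choiceType) (D : set I) (X : I -> T -> R[i]) :
    Prop :=
  forall (J : {fset I}) (A : I -> set (R * R)),
    [set` J] `<=` D -> (forall i, measurable (A i)) ->
    P (\bigcap_(i in [set` J]) [set w | A i (plane (X i w))]) =
    (\prod_(i <- J) P [set w | A i (plane (X i w))])%E.

(* The value [f 0] is irrelevant. *)
Record steinhaus {d : measure_display} {T : measurableType d}
    (P : probability T R) (f : nat -> T -> R[i]) : Prop := Steinhaus {
  steinhaus1 : forall w, f 1%N w = 1 ;
  steinhausM : forall (m n : nat) w, (0 < m)%N -> (0 < n)%N ->
    f (m * n)%N w = f m w * f n w ;
  steinhaus_measurable : forall p, prime p ->
    measurable_fun [set: T] (fun w => plane (f p w)) ;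
  steinhaus_uniform : forall p, prime p -> uniform_on_circle P (f p) ;
  steinhaus_independent : mutually_independent P [set p | prime p] f }.

End complex_random_variables.

(* Main.v *)
(* McLeish's martingale method.  Grouping the integers of [S] by their largest
   prime factor writes the truncated sum as [sum_p Z_p], and
   [X_p = t1 Re Z_p + t2 Im Z_p] is a martingale difference sequence, because
   every monomial of [Z_p] contains a positive power of [f p].  Orthogonality
   of the [f n] turns hypotheses (2) and (3) into the bounds
   [E (sum |Z_p|^2 - 1)^2 = O(eps^2)] and
   [sum E |Z_p|^4 = E |sum Z_p^2|^2 = O(eps^4)], so [Q = sum X_p^2] is close to
   [t^2] in [L^2].  Since [e^{ix} = (1 + ix) e^{-x^2/2} + O(|x|^3 + x^4)] and
   [|(1 + ix) e^{-x^2/2}| <= 1], one may replace [e^{i sum X_p}] by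
   [prod (1 + i X_p) e^{-Q/2}].  The product, stopped when the partial sums of
   [Q] exceed [2 t^2], has expectation 1 and is bounded well enough to replace
   [e^{-Q/2}] by [e^{-t^2/2}].  All error terms are made affine in
   [(Q - t^2)^2] and [sum X_p^4] by the arithmetic-geometric inequality, so only
   linearity of the expectation is used. *)
Require Import Defs.
From HB Require Import structures.
From mathcomp Require Import all_boot all_order all_algebra.
From mathcomp Require Import finmap.
From mathcomp Require Import complex.
From mathcomp Require Import all_classical all_reals all_analysis.
From mathcomp Require Import measurable_realfun ring lra.

Set Implicit Arguments.
Unset Strict Implicit.
Unset Printing Implicit Defensive.

Import Order.TTheory GRing.Theory Num.Theory.
Import numFieldNormedType.Exports.

Local Open Scope classical_set_scope.
Local Open Scope ring_scope.

(** * Trigonometric bounds *)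

Section trigonometric_bounds.
Context {R : realType}.
Implicit Types x y u : R.

(** A Steinhaus function lies on the unit circle only almost surely. All the work is therefore done
    with an everywhere unimodular version: every random variable is then bounded, and integrability
    is automatic. No conditional expectation is formed; its substitute is that a bounded function of
    the [f q], [q <> p], times a positive power of [f p] has mean zero. Each fourth-order quantity
    is expanded over quadruples, and its expectation keeps those with [m1 m2 = n1 n2]. In
    [(sum |Z_p|^2)^2] the diagonal is the main term and (2) bounds the rest. In [|sum Z_p^2|^2] only
    the two left and the two right largest primes are matched, but the product equation forces all
    four to agree, so (3) bounds it as well as [sum |Z_p|^4]. The powers of [eps] fit the
    arithmetic-geometric step: it trades [|Q - t^2|] for [(Q - t^2)^2 / eps] and [|x|^3] for
    [x^4 / eps], up to terms of size [eps], so moments of sizes [eps^2] and [eps^4] leave an error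
    of order [eps]. *)

Lemma mvt_bound (f df : R -> R) (x B : R) :
  (forall y, is_derive y 1 f (df y)) ->
  (forall y, `|y| <= `|x| -> `|df y| <= B) ->
  `|f x - f 0| <= B * `|x|.
Proof.
move=> fdf dfB.
have cf : continuous f.
  by move=> y; apply: differentiable_continuous; apply/derivable1_diffP;
    have [] := fdf y.
have wcf a b : {within `[a, b], continuous f} by exact: continuous_subspaceT.
have [x0|x0] := leP 0 x.
- have [c] := MVT_segment x0 (fun y _ => fdf y) (wcf _ _).
  rewrite in_itv/= subr0 => /andP[c0 cx] ->; rewrite normrM ler_wpM2r//.
  by apply: dfB; rewrite !ger0_norm.
- have [c] := MVT_segment (ltW x0) (fun y _ => fdf y) (wcf _ _).
  rewrite in_itv/= sub0r distrC => /andP[c0 cx] ->.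
  rewrite normrM normrN ler_wpM2r//.
  by apply: dfB; rewrite !ler0_norm// ?lerN2// ltW.
Qed.

Lemma sin_lip x y : `|sin x - sin y| <= `|x - y|.
Proof.
have := @mvt_bound (fun z => sin (z + y)) (fun z => cos (z + y)) (x - y) 1.
rewrite add0r subrK mul1r; apply => [z|z _]; last exact: cos_max.
apply: is_derive_eq.
by rewrite addr0 mulr1.
Qed.

Lemma cos_lip x y : `|cos x - cos y| <= `|x - y|.
Proof.
have := @mvt_bound (fun z => cos (z + y)) (fun z => - sin (z + y)) (x - y) 1.
rewrite add0r subrK mul1r; apply => [z|z _]; last by rewrite normrN sin_max.
apply: is_derive_eq.
by rewrite addr0 mulr1.
Qed.

(** Each Taylor bound comes from the preceding one by the mean value inequality applied to the
    remainder. The factorials are lost; only the order in [x] matters here. *)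
Lemma cos_taylor1 x : `|1 - cos x| <= x ^+ 2.
Proof.
have := @mvt_bound cos (fun z => - sin z) x `|x|.
rewrite cos0 distrC -expr2 real_normK ?num_real//; apply => z zx.
by rewrite normrN (le_trans _ zx)//; have := sin_lip z 0; rewrite sin0 !subr0.
Qed.

Lemma sin_taylor1 x : `|sin x - x| <= `|x| ^+ 3.
Proof.
have := @mvt_bound (fun z => sin z - z) (fun z => cos z - 1) x (`|x| ^+ 2).
rewrite sin0 !subr0 -exprSr; apply => z zx.
rewrite distrC (le_trans (cos_taylor1 _))// -[z ^+ 2]real_normK ?num_real//.
by rewrite lerXn2r ?nnegrE.
Qed.

Lemma cos_taylor2 x : `|cos x - (1 - x ^+ 2 / 2)| <= x ^+ 4.
Proof.
have -> : x ^+ 4 = `|x| ^+ 3 * `|x|.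
  by rewrite -exprSr -[LHS]ger0_norm ?normrX// exprn_even_ge0.
have := @mvt_bound (fun z => cos z - (1 - z ^+ 2 / 2)) (fun z => - sin z + z) x
  (`|x| ^+ 3).
rewrite cos0 expr0n/= mul0r !subr0 subrr subr0; apply => [z|z zx].
  by apply: is_derive_eq; rewrite /GRing.scale/=; field.
rewrite addrC distrC (le_trans (sin_taylor1 _))//.
by rewrite lerXn2r ?nnegrE.
Qed.

End trigonometric_bounds.

(** * Bounded measurable functions and their expectation *)

Section bounded_measurable.
Context {R : realType} {d : measure_display} {T : measurableType d}.
Implicit Types (X Y : T -> R) (F G : T -> R[i]).

(** A class closed under the ring operations and contained in the integrable functions. Because the
    measurable structure of [T] is a parameter, the same predicate on a coarser sigma-algebra also
    expresses dependence on only some of the [f q]. *)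
Definition bmeas X :=
  measurable_fun [set: T] X /\ exists M, forall w, `|X w| <= M.

Definition cbmeas F :=
  bmeas (fun w => complex.Re (F w)) /\ bmeas (fun w => complex.Im (F w)).

Lemma bmeas_cst (c : R) : bmeas (fun=> c).
Proof. by split; [exact: measurable_cst|exists `|c|]. Qed.

Lemma bmeasD X Y : bmeas X -> bmeas Y -> bmeas (fun w => X w + Y w).
Proof.
move=> [mX [M XM]] [mY [K YK]]; split; first exact: measurable_funD.
by exists (M + K) => w; rewrite (le_trans (ler_normD _ _))// lerD.
Qed.

Lemma bmeasM X Y : bmeas X -> bmeas Y -> bmeas (fun w => X w * Y w).
Proof.
move=> [mX [M XM]] [mY [K YK]]; split; first exact: measurable_funM.
by exists (M * K) => w; rewrite normrM ler_pM.
Qed.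

Lemma bmeasN X : bmeas X -> bmeas (fun w => - X w).
Proof.
move=> [mX [M XM]]; split; first exact: measurableT_comp.
by exists M => w; rewrite normrN.
Qed.

Lemma bmeasB X Y : bmeas X -> bmeas Y -> bmeas (fun w => X w - Y w).
Proof. by move=> bX bY; apply: bmeasD => //; exact: bmeasN. Qed.

Lemma bmeas_sum (I : Type) (r : seq I) (A : pred I) (X : I -> T -> R) :
  (forall i, A i -> bmeas (X i)) -> bmeas (fun w => \sum_(i <- r | A i) X i w).
Proof.
move=> bX; elim: r => [|i r IH].
  by under eq_fun do rewrite big_nil; exact: bmeas_cst.
under eq_fun do rewrite big_cons.
by have [Ai|_] := boolP (A i) => //; apply: bmeasD => //; exact: bX.
Qed.

Lemma bmeasX X n : bmeas X -> bmeas (fun w => X w ^+ n).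
Proof.
move=> bX; elim: n => [|n IH].
  by under eq_fun do rewrite expr0; exact: bmeas_cst.
by under eq_fun do rewrite exprS; exact: bmeasM.
Qed.

Lemma bmeas_le X (c : R) : bmeas X -> bmeas (fun w => (X w <= c)%R%:R).
Proof.
move=> [mX _]; split; last first.
  by exists 1 => w; case: (X w <= c); rewrite ?normr1 ?normr0 ?ler01.
rewrite (_ : (fun _ => _) = fun w => if X w <= c then 1 else 0); last first.
  by apply/funext => w; case: (X w <= c).
apply: measurable_fun_ifT; [|exact: measurable_cst..].
by apply: measurable_fun_ler => //; exact: measurable_cst.
Qed.

Lemma bmeas_cos X : measurable_fun [set: T] X -> bmeas (fun w => cos (X w)).
Proof.
move=> mX; split; last by exists 1 => w; exact: cos_max.
apply: measurableT_comp mX.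
by apply: continuous_measurable_fun => ?; exact: continuous_cos.
Qed.

Lemma bmeas_sin X : measurable_fun [set: T] X -> bmeas (fun w => sin (X w)).
Proof.
move=> mX; split; last by exists 1 => w; exact: sin_max.
apply: measurableT_comp mX.
by apply: continuous_measurable_fun => ?; exact: continuous_sin.
Qed.

Lemma cbmeas_cst (c : R[i]) : cbmeas (fun=> c).
Proof. by split; exact: bmeas_cst. Qed.

Lemma cbmeas_real X : bmeas X -> cbmeas (fun w => (X w)%:C%C).
Proof. by split => //; exact: bmeas_cst. Qed.

Lemma cbmeasD F G : cbmeas F -> cbmeas G -> cbmeas (fun w => F w + G w).
Proof.
move=> [bF cF] [bG cG]; split.
- by under eq_fun do rewrite raddfD; exact: bmeasD.
- by under eq_fun do rewrite raddfD; exact: bmeasD.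
Qed.

Lemma Re_mulc (x y : R[i]) : complex.Re (x * y) =
  complex.Re x * complex.Re y - complex.Im x * complex.Im y.
Proof. by case: x; case: y. Qed.

Lemma Im_mulc (x y : R[i]) : complex.Im (x * y) =
  complex.Re x * complex.Im y + complex.Im x * complex.Re y.
Proof. by case: x; case: y. Qed.

Lemma Re_conjc (x : R[i]) : complex.Re (x^*)%C = complex.Re x.
Proof. by case: x. Qed.

Lemma Im_conjc (x : R[i]) : complex.Im (x^*)%C = - complex.Im x.
Proof. by case: x. Qed.

Lemma cbmeasM F G : cbmeas F -> cbmeas G -> cbmeas (fun w => F w * G w).
Proof.
move=> [bF cF] [bG cG]; split.
- by under eq_fun do rewrite Re_mulc; apply: bmeasB; exact: bmeasM.
- by under eq_fun do rewrite Im_mulc; apply: bmeasD; exact: bmeasM.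
Qed.

Lemma cbmeas_conj F : cbmeas F -> cbmeas (fun w => (F w)^*%C).
Proof.
move=> [bF cF]; split; first by under eq_fun do rewrite Re_conjc.
by under eq_fun do rewrite Im_conjc; exact: bmeasN.
Qed.

Lemma cbmeas_sum (I : Type) (r : seq I) (A : pred I) (F : I -> T -> R[i]) :
  (forall i, A i -> cbmeas (F i)) ->
  cbmeas (fun w => \sum_(i <- r | A i) F i w).
Proof.
move=> bF; elim: r => [|i r IH].
  by under eq_fun do rewrite big_nil; exact: cbmeas_cst.
under eq_fun do rewrite big_cons.
by have [Ai|_] := boolP (A i) => //; apply: cbmeasD => //; exact: bF.
Qed.

Lemma cbmeasX F n : cbmeas F -> cbmeas (fun w => F w ^+ n).
Proof.
move=> bF; elim: n => [|n IH].
  by under eq_fun do rewrite expr0; exact: cbmeas_cst.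
by under eq_fun do rewrite exprS; exact: cbmeasM.
Qed.

Lemma cbmeas_prod (I : Type) (r : seq I) (A : pred I) (F : I -> T -> R[i]) :
  (forall i, A i -> cbmeas (F i)) ->
  cbmeas (fun w => \prod_(i <- r | A i) F i w).
Proof.
move=> bF; elim: r => [|i r IH].
  by under eq_fun do rewrite big_nil; exact: cbmeas_cst.
under eq_fun do rewrite big_cons.
by have [Ai|_] := boolP (A i) => //; apply: cbmeasM => //; exact: bF.
Qed.

Lemma cbmeas_expi X : measurable_fun [set: T] X -> cbmeas (fun w => expi (X w)).
Proof. by split; [exact: bmeas_cos|exact: bmeas_sin]. Qed.

End bounded_measurable.

Section expectation.
Context {R : realType} {d : measure_display} {T : measurableType d}.
Variable P : probability T R.
Implicit Types (X Y : T -> R) (F G : T -> R[i]).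

Definition rexp X : R := fine ('E_P[X]).

Lemma rexpE X : rexp X = Rintegral P setT X.
Proof. by rewrite /rexp unlock. Qed.

Lemma bmeas_integrable X : bmeas X -> P.-integrable setT (EFin \o X).
Proof.
move=> [mX [M XM]]; apply: measurable_bounded_integrable => //.
- by apply: le_lt_trans (probability_le1 P measurableT) _; rewrite ltry.
- exists M; split; first exact: num_real.
  by move=> K MK w _; apply: le_trans (XM w) (ltW MK).
Qed.

Lemma rexp_cst (c : R) : rexp (fun=> c) = c.
Proof. by rewrite /rexp expectation_cst. Qed.

Lemma rexpD X Y : bmeas X -> bmeas Y ->
  rexp (fun w => X w + Y w) = rexp X + rexp Y.
Proof.
by move=> bX bY; rewrite !rexpE RintegralD//; exact: bmeas_integrable.
Qed.

Lemma rexpZ (c : R) X : bmeas X -> rexp (fun w => c * X w) = c * rexp X.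
Proof. by move=> bX; rewrite !rexpE RintegralZl//; exact: bmeas_integrable. Qed.

Lemma rexpN X : bmeas X -> rexp (fun w => - X w) = - rexp X.
Proof.
move=> bX; rewrite -mulN1r -rexpZ//; congr rexp.
by apply/funext => w; rewrite mulN1r.
Qed.

Lemma rexpB X Y : bmeas X -> bmeas Y ->
  rexp (fun w => X w - Y w) = rexp X - rexp Y.
Proof. by move=> bX bY; rewrite rexpD ?rexpN//; exact: bmeasN. Qed.

Lemma ler_rexp X Y : bmeas X -> bmeas Y -> (forall w, X w <= Y w) ->
  rexp X <= rexp Y.
Proof.
move=> bX bY XY; rewrite !rexpE; apply: le_Rintegral => //;
  exact: bmeas_integrable.
Qed.

Lemma ler_norm_rexp X Y : bmeas X -> bmeas Y -> (forall w, `|X w| <= Y w) ->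
  `|rexp X| <= rexp Y.
Proof.
move=> bX bY XY; rewrite ler_norml; apply/andP; split.
  rewrite lerNl -rexpN//; apply: ler_rexp => //; first exact: bmeasN.
  by move=> w; rewrite lerNl; have := XY w; rewrite ler_norml => /andP[].
by apply: ler_rexp => // w; apply: le_trans (ler_norm _) (XY w).
Qed.

Local Notation cE := (cexpectation P).

Lemma cexpE F : cE F = Complex (rexp (fun w => complex.Re (F w)))
                               (rexp (fun w => complex.Im (F w))).
Proof. by []. Qed.

Lemma eq_cexp F G : F =1 G -> cE F = cE G.
Proof. by move=> /funext ->. Qed.

Lemma cexp_cst (c : R[i]) : cE (fun=> c) = c.
Proof. by rewrite cexpE !rexp_cst; case: c. Qed.

Lemma cexpD F G : cbmeas F -> cbmeas G ->
  cE (fun w => F w + G w) = cE F + cE G.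
Proof.
move=> [bF cF] [bG cG]; rewrite !cexpE.
under [in LHS]eq_fun do rewrite raddfD.
by under [X in Complex _ (rexp X)]eq_fun do rewrite raddfD; rewrite !rexpD.
Qed.

Lemma cexpZ (c : R[i]) F : cbmeas F -> cE (fun w => c * F w) = c * cE F.
Proof.
move=> [bF cF]; rewrite !cexpE.
under [in LHS]eq_fun do rewrite Re_mulc.
under [X in Complex _ (rexp X)]eq_fun do rewrite Im_mulc.
have bZ (k : R) X : bmeas X -> bmeas (fun w => k * X w).
  by move=> bX; apply: bmeasM => //; exact: bmeas_cst.
rewrite rexpB ?rexpD ?rexpZ //; try exact: bZ.
by case: c.
Qed.

Lemma cexpN F : cbmeas F -> cE (fun w => - F w) = - cE F.
Proof.
move=> bF; rewrite -mulN1r -cexpZ//; apply: eq_cexp => w.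
by rewrite mulN1r.
Qed.

Lemma cexp_conj F : cbmeas F -> cE (fun w => (F w)^*%C) = (cE F)^*%C.
Proof.
move=> [bF cF]; rewrite !cexpE.
under [in LHS]eq_fun do rewrite Re_conjc.
by under [X in Complex _ (rexp X)]eq_fun do rewrite Im_conjc; rewrite rexpN.
Qed.

Lemma cexp_sum (I : Type) (r : seq I) (A : pred I) (F : I -> T -> R[i]) :
  (forall i, A i -> cbmeas (F i)) ->
  cE (fun w => \sum_(i <- r | A i) F i w) = \sum_(i <- r | A i) cE (F i).
Proof.
move=> bF; elim: r => [|i r IH].
  by under eq_cexp do rewrite big_nil; rewrite cexp_cst big_nil.
under eq_cexp do rewrite big_cons; rewrite big_cons -IH.
have [Ai|_] := boolP (A i) => //; rewrite cexpD//; first exact: bF.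
exact: cbmeas_sum.
Qed.

End expectation.

(** * Laws of random variables and of independent pairs *)

Section image_law.
Context {R : realType} {d d1 : measure_display} {T : measurableType d}
  {T1 : measurableType d1}.
Variable P : probability T R.

Lemma bmeas_comp (X : T -> T1) (h : T1 -> R) :
  measurable_fun [set: T] X -> bmeas h -> bmeas (fun w => h (X w)).
Proof.
move=> mX [mh [M hM]]; split; first exact: measurableT_comp mX.
by exists M => w; exact: hM.
Qed.

Lemma rexp_law (Q : probability T1 R) (X : T -> T1) (h : T1 -> R) :
  measurable_fun [set: T] X -> bmeas h ->
  (forall A, measurable A -> P (X @^-1` A) = Q A) ->
  rexp P (fun w => h (X w)) = rexp Q h.
Proof.
move=> mX bh PQ.
pose X' : {mfun T >-> T1} := HB.pack X (isMeasurableFun.Build _ _ _ _ _ mX).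
rewrite !rexpE /Rintegral.
rewrite -(integral_distribution (X := X') (f := EFin \o h)); last 2 first.
- by apply/measurable_EFinP; case: bh.
- by apply: bmeas_integrable; exact: bmeas_comp.
by congr fine; apply: eq_measure_integral => A mA _; exact: PQ.
Qed.

End image_law.

Section product_law.
Context {R : realType} {d d1 d2 : measure_display} {T : measurableType d}
  {T1 : measurableType d1} {T2 : measurableType d2}.
Variable P : probability T R.

(** The law of the pair agrees with the product of the two laws on rectangles, hence everywhere by
    uniqueness of product measures; Fubini then splits the integral. The target spaces are
    arbitrary, so that [X] can be the identity onto a coarser sigma-algebra. *)
Lemma rexp_indep (X : T -> T1) (Y : T -> T2) (h : T1 -> R) (g : T2 -> R) :
  measurable_fun [set: T] X -> measurable_fun [set: T] Y ->
  bmeas h -> bmeas g ->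
  (forall A B, measurable A -> measurable B ->
    P (X @^-1` A `&` Y @^-1` B) = (P (X @^-1` A) * P (Y @^-1` B))%E) ->
  rexp P (fun w => h (X w) * g (Y w)) =
  rexp P (fun w => h (X w)) * rexp P (fun w => g (Y w)).
Proof.
move=> mX mY bh bg XY.
pose X' : {mfun T >-> T1} := HB.pack X (isMeasurableFun.Build _ _ _ _ _ mX).
pose Y' : {mfun T >-> T2} := HB.pack Y (isMeasurableFun.Build _ _ _ _ _ mY).
pose m1 : probability T1 R := distribution P X'.
pose m2 : probability T2 R := distribution P Y'.
have mXY : measurable_fun [set: T] (fun w => (X w, Y w)).
  exact: measurable_fun_pair.
pose XY' : {mfun T >-> (T1 * T2)%type} :=
  HB.pack (fun w => (X w, Y w)) (isMeasurableFun.Build _ _ _ _ _ mXY).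
pose f z := h z.1 * g z.2.
have bf : bmeas f.
  case: bh bg => mh [M hM] [mg [K gK]]; split.
    by apply: measurable_funM; [exact: measurableT_comp mh _|
      exact: measurableT_comp mg _].
  by exists (M * K) => z; rewrite normrM ler_pM.
have lawE A : measurable A -> P ((fun w => (X w, Y w)) @^-1` A) = (m1 \x m2)%E A.
  move=> mA; apply/esym.
  exact: (@product_measure_unique _ _ _ _ _ m1 m2 (distribution P XY')) mA.
rewrite (rexp_law (Q := (m1 \x m2)%E) mXY bf lawE).
rewrite (rexp_law (Q := m1) mX bh)// (rexp_law (Q := m2) mY bg)//.
have m2g : (\int[m2]_y (g y)%:E = (rexp m2 g)%:E)%E.
  rewrite rexpE /Rintegral fineK//.
  by apply: integrable_fin_num => //; exact: bmeas_integrable.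
rewrite [LHS]rexpE /Rintegral -integral12_prod_meas1; last first.
  exact: bmeas_integrable.
under eq_integral => x _.
  rewrite /fubini_F /f /=.
  under eq_integral do rewrite EFinM.
  rewrite integralZl//; last exact: bmeas_integrable.
  rewrite m2g muleC; over.
rewrite integralZl//; last exact: bmeas_integrable.
rewrite fineM//; last by apply: integrable_fin_num => //; exact: bmeas_integrable.
by rewrite mulrC; congr (_ * _); rewrite rexpE.
Qed.

End product_law.

(** * The unit circle and its uniform law *)

Section circle.
Context {R : realType}.

Lemma expiD (x y : R) : expi (x + y) = expi x * expi y.
Proof.
by rewrite /expi cosD sinD; apply/eqP; rewrite eq_complex/= eqxx addrC eqxx.
Qed.

Lemma expi0 : expi (0 : R) = 1.
Proof. by rewrite /expi cos0 sin0. Qed.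

Lemma expiX (x : R) k : expi x ^+ k = expi (k%:R * x).
Proof.
elim: k => [|k IH]; first by rewrite mul0r expi0.
by rewrite exprS IH -expiD -natr1 mulrDl mul1r addrC.
Qed.

(* The identity on the unit circle, and 1 elsewhere: a Steinhaus function is
   only almost surely unimodular. *)
Definition clip (y : R * R) : R[i] :=
  if y.1 ^+ 2 + y.2 ^+ 2 == 1 then Complex y.1 y.2 else 1.

Lemma clip_plane (z : R[i]) :
  complex.Re z ^+ 2 + complex.Im z ^+ 2 = 1 -> clip (plane z) = z.
Proof. by rewrite /clip/= => /eqP ->; case: z. Qed.

Lemma clip_expi (x : R) : clip (plane (expi x)) = expi x.
Proof. exact/clip_plane/cos2Dsin2. Qed.

Lemma clip_norm (y : R * R) : clip y * (clip y)^*%C = 1.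
Proof.
rewrite /clip; case: ifPn => [/eqP y1|_]; last by rewrite conjc1 mulr1.
apply/eqP; rewrite eq_complex/= mulrN opprK -!expr2 y1 eqxx/=.
by rewrite mulrN addrC mulrC subrr.
Qed.

Lemma cbmeas_clip : cbmeas clip.
Proof.
pose c (y : R * R) := y.1 ^+ 2 + y.2 ^+ 2 == 1.
have mc : measurable_fun [set: R * R] c.
  apply: measurable_fun_eqr; last exact: measurable_cst.
  by apply: measurable_funD; apply: measurable_funX.
have mcase (g h : R * R -> R) : measurable_fun [set: R * R] g ->
    measurable_fun [set: R * R] h ->
    measurable_fun [set: R * R] (fun y => if c y then g y else h y).
  by move=> mg mh; exact: measurable_fun_ifT.
have Hle (x y : R) : x ^+ 2 + y ^+ 2 = 1 -> `|x| <= 1.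
  move=> xy; rewrite -(@ler_pXn2r _ 2)// ?nnegrE// real_normK ?num_real//.
  by rewrite expr1n -xy lerDl sqr_ge0.
split; split.
- have -> : (fun y => complex.Re (clip y)) = fun y => if c y then y.1 else 1.
    by apply/funext => y; rewrite /clip /c; case: ifP.
  by apply: mcase => //; exact: measurable_cst.
- exists 1 => y; rewrite /clip; case: ifPn => [/eqP/Hle//|_ /=].
  by rewrite normr1.
- have -> : (fun y => complex.Im (clip y)) = fun y => if c y then y.2 else 0.
    by apply/funext => y; rewrite /clip /c; case: ifP.
  by apply: mcase => //; exact: measurable_cst.
- exists 1 => y; rewrite /clip; case: ifPn => [/eqP|_ /=].
    by rewrite addrC => /Hle.
  by rewrite normr0.
Qed.

Lemma measurable_plane_expi :
  measurable_fun [set: R] (fun x : R => plane (expi x)).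
Proof.
apply: measurable_fun_pair.
- by apply: continuous_measurable_fun => ?; exact: continuous_cos.
- by apply: continuous_measurable_fun => ?; exact: continuous_sin.
Qed.

End circle.

Section uniform_angle.
Context {R : realType}.
Local Notation U := (uniform_prob (@pi2_gt0 R)).

(** Density of the uniform law followed by the fundamental theorem of calculus. The density formula
    is applied to nonnegative integrands, so the cosine and sine moments below are computed after
    adding 1. *)
Lemma rexp_uniform (g G : R -> R) : continuous g ->
  (forall x, 0 <= g x) -> (exists M, forall x, `|g x| <= M) ->
  (forall x : R, is_derive x 1 G (g x)) ->
  rexp U g = (pi *+ 2)^-1 * (G (pi *+ 2) - G 0).
Proof.
move=> cg g0 bg dG.
have mg : measurable_fun [set: R] g by exact: continuous_measurable_fun.
rewrite rexpE /Rintegral integral_uniform; last 2 first.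
- exact/measurable_EFinP.
- by move=> x; rewrite lee_fin.
have cG : continuous G.
  by move=> y; apply: differentiable_continuous; apply/derivable1_diffP;
    have [] := dG y.
rewrite (@continuous_FTC2 _ g G)//.
- by rewrite subr0.
- exact: pi2_gt0.
- exact: continuous_subspaceT.
- split.
  + by move=> x _; have [] := dG x.
  + by apply: cvg_at_right_filter; exact: cG.
  + by apply: cvg_at_left_filter; exact: cG.
- by move=> x _; rewrite derive1E; have [_ ->] := dG x.
Qed.

Lemma rexp_uniform_cos k : (0 < k)%N ->
  rexp U (fun x => cos (k%:R * x)) = 0.
Proof.
move=> k0; have kn0 : k%:R != 0 :> R by rewrite pnatr_eq0 -lt0n.
have mk : measurable_fun [set: R] (fun x : R => k%:R * x).
  by apply: measurable_funM => //; exact: measurable_cst.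
have dG (x : R) : is_derive x 1 (fun x => x + k%:R^-1 * sin (k%:R * x))
    (1 + cos (k%:R * x)).
  by apply: is_derive_eq; rewrite /GRing.scale/=; field.
have : rexp U (fun x => 1 + cos (k%:R * x)) = 1.
  rewrite (rexp_uniform _ _ _ dG).
  - rewrite mulr0 sin0 mulr0 addr0 subr0 mulr_natl.
    have -> : pi *+ 2 *+ k = 0 + (pi *+ 2) *+ k :> R by rewrite add0r.
    by rewrite (periodicn (@sinD2pi R)) sin0 mulr0 addr0 mulVf// gt_eqF// pi2_gt0.
  - move=> x; apply: cvgD; first exact: cvg_cst.
    apply: (@continuous_comp _ _ _ (fun x : R => k%:R * x) cos);
      last exact: continuous_cos.
    by apply: cvgM; [exact: cvg_cst|exact: cvg_id].
  - by move=> x; rewrite -lerBlDl sub0r cos_geN1.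
  - exists (1 + 1) => x; rewrite (le_trans (ler_normD _ _))// normr1 lerD2l.
    exact: cos_max.
rewrite rexpD ?rexp_cst.
- by move=> h; lra.
- exact: bmeas_cst.
- exact: bmeas_cos.
Qed.

Lemma rexp_uniform_sin k : (0 < k)%N ->
  rexp U (fun x => sin (k%:R * x)) = 0.
Proof.
move=> k0; have kn0 : k%:R != 0 :> R by rewrite pnatr_eq0 -lt0n.
have mk : measurable_fun [set: R] (fun x : R => k%:R * x).
  by apply: measurable_funM => //; exact: measurable_cst.
have dG (x : R) : is_derive x 1 (fun x => x - k%:R^-1 * cos (k%:R * x))
    (1 + sin (k%:R * x)).
  by apply: is_derive_eq; rewrite /GRing.scale/=; field.
have : rexp U (fun x => 1 + sin (k%:R * x)) = 1.
  rewrite (rexp_uniform _ _ _ dG).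
  - rewrite mulr0 cos0 sub0r mulr_natl.
    have -> : pi *+ 2 *+ k = 0 + (pi *+ 2) *+ k :> R by rewrite add0r.
    rewrite (periodicn (@cosD2pi R)) cos0 opprK subrK mulVf//.
    by rewrite gt_eqF// pi2_gt0.
  - move=> x; apply: cvgD; first exact: cvg_cst.
    apply: (@continuous_comp _ _ _ (fun x : R => k%:R * x) sin);
      last exact: continuous_sin.
    by apply: cvgM; [exact: cvg_cst|exact: cvg_id].
  - by move=> x; rewrite -lerBlDl sub0r sin_geN1.
  - exists (1 + 1) => x; rewrite (le_trans (ler_normD _ _))// normr1 lerD2l.
    exact: sin_max.
rewrite rexpD ?rexp_cst.
- by move=> h; lra.
- exact: bmeas_cst.
- exact: bmeas_sin.
Qed.

End uniform_angle.

(** * Independence and orthogonality *)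

Section independence.
Context {R : realType} {d : measure_display} {T : measurableType d}.
Variables (P : probability T R) (f : nat -> T -> R[i]).
Hypothesis sf : steinhaus P f.

Definition cylinders (p : nat) : set (set T) :=
  [set B | exists (J : {fset nat}) (A : nat -> set (R * R)),
     [/\ forall q, q \in J -> prime q && (q != p),
         forall q, measurable (A q) &
         B = \bigcap_(q in [set` J]) [set w | A q (plane (f q w))]]].

(* The sigma-algebra generated by the [f q], [q] prime, [q <> p]. *)
Definition others (p : nat) := g_sigma_algebraType (cylinders p).

Lemma measurable_steinhaus_preimage p (C : set (R * R)) : prime p ->
  measurable C -> measurable [set w | C (plane (f p w))].
Proof.
move=> pp mC; have := steinhaus_measurable sf pp measurableT mC.
by rewrite setTI.
Qed.

Lemma cylinders_measurable p : cylinders p `<=` measurable.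
Proof.
move=> _ [J [A [JP mA ->]]]; apply: bigcap_measurableType => q /= qJ.
by apply: measurable_steinhaus_preimage => //; case/andP: (JP q qJ).
Qed.

Lemma others_measurable p (B : set T) :
  measurable (B : set (others p)) -> measurable B.
Proof.
apply: smallest_sub; first exact: sigma_algebra_measurable.
exact: cylinders_measurable.
Qed.

Lemma cylinders_setI_closed p : setI_closed (cylinders p).
Proof.
move=> _ _ [J [A [JP mA ->]]] [K [B [KP mB ->]]].
(* Each family of events is extended by the full set outside its own index set. *)
exists (J `|` K)%fset; exists (fun q => (if q \in J then A q else setT) `&`
  (if q \in K then B q else setT)); split.
- by move=> q; rewrite in_fsetU => /orP[/JP|/KP].
- by move=> q; apply: measurableI; case: ifP.
- apply/seteqP; split => w.
    move=> [wJ wK] q /= _; split; case: ifP => // qJ; [exact: wJ|exact: wK].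
  move=> wJK; split => q /= qJ.
    by have [] := wJK q; rewrite /= ?in_fsetU qJ.
  by have [] := wJK q; rewrite /= ?in_fsetU qJ ?orbT.
Qed.

(** Mutual independence is used twice: for [J], and for [J] enlarged by [p], with [C] as the event
    at [p]. The product over the larger set has exactly one more factor. *)
Lemma cylinder_indep p (B : set T) (C : set (R * R)) : prime p ->
  cylinders p B -> measurable C ->
  P (B `&` [set w | C (plane (f p w))]) =
  (P B * P [set w | C (plane (f p w))])%E.
Proof.
move=> pp [J [A [JP mA ->]]] mC.
have pJ : p \notin J by apply/negP => /JP; rewrite eqxx andbF.
pose A' q := if q == p then C else A q.
have A'J q : q \in J -> A' q = A q.
  by move=> /JP/andP[_ /negbTE qp]; rewrite /A' qp.
have JD : [set` J] `<=` [set q | prime q] by move=> q /= /JP/andP[].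
have -> : \bigcap_(q in [set` J]) [set w | A q (plane (f q w))] `&`
    [set w | C (plane (f p w))] =
    \bigcap_(q in [set` (p |` J)%fset]) [set w | A' q (plane (f q w))].
  apply/seteqP; split => w /=.
    move=> [wJ wC] q /=; rewrite in_fset1U => /predU1P[->|qJ].
      by rewrite /A' eqxx.
    by rewrite A'J//; exact: wJ.
  move=> wJ; split=> [q /= qJ|].
    by have := wJ q; rewrite /= A'J// in_fset1U qJ orbT; exact.
  by have := wJ p; rewrite /= /A' eqxx in_fset1U eqxx; exact.
rewrite (steinhaus_independent sf); last 2 first.
- by move=> q /=; rewrite in_fset1U => /predU1P[->//|/JD].
- by move=> q; rewrite /A'; case: ifP.
rewrite (steinhaus_independent sf)// big_fsetU1//= muleC.
rewrite {2}/A' eqxx; congr (_ * _)%E.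
by apply: eq_big_seq => q qJ; rewrite A'J.
Qed.

(** For a fixed event [E] on [f p], the sets [B] with [P (B & E) = P B * P E] form a Dynkin class;
    it contains the intersection-stable cylinders, hence the sigma-algebra they generate. *)
Lemma others_indep p (B : set (others p)) (C : set (R * R)) : prime p ->
  measurable B -> measurable C ->
  P ((B : set T) `&` [set w | C (plane (f p w))]) =
  (P B * P [set w | C (plane (f p w))])%E.
Proof.
move=> pp mB mC; set E := [set w | C _].
have mE : measurable E by exact: measurable_steinhaus_preimage.
have PEf : P E \is a fin_num by exact: fin_num_measure.
move: B mB; apply: (@dynkin_induction _ (others p) (cylinders p)
  (fun B : set (others p) => P ((B : set T) `&` E) = (P B * P E)%E)) => //.
- exact: cylinders_setI_closed.
- by rewrite setTI [P setT]probability_setT mul1e.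
- by move=> B cB; exact: cylinder_indep.
- move=> B /others_measurable mB PB.
  rewrite setIC -setDE measureD//; last first.
    by apply: le_lt_trans (probability_le1 P mE) _; rewrite ltry.
  transitivity (P E - P B * P E)%E.
    by congr (_ - _)%E; rewrite setIC; exact: PB.
  rewrite probability_setC//.
  have PBf : P B \is a fin_num by exact: fin_num_measure.
  rewrite -(fineK PEf) -(fineK PBf).
  by rewrite -EFinM -!EFinB -EFinM; congr EFin; ring.
- move=> B mB tB PB.
  have mB' n : measurable (B n : set T) := others_measurable (mB n).
  rewrite setI_bigcupl !measure_semi_bigcup//.
  + transitivity (\sum_(n <oo) P E * P (B n))%E.
      by apply: eq_eseriesr => n _; rewrite muleC; exact: PB.
    by rewrite -(fineK PEf) nneseriesZl// muleC.
  + exact: bigcupT_measurable.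
  + by move=> n; exact: measurableI.
  + exact: trivIset_setIr.
  + by apply: bigcupT_measurable => n; exact: measurableI.
Qed.

Lemma others_bmeas p (h : T -> R) : bmeas (h : others p -> R) -> bmeas h.
Proof.
move=> [mh bh]; split=> // _ A mA; apply: others_measurable.
exact: mh.
Qed.

Lemma others_cbmeas p (H : T -> R[i]) :
  cbmeas (H : others p -> R[i]) -> cbmeas H.
Proof. by move=> [bH cH]; split; [exact: others_bmeas bH|exact: others_bmeas cH]. Qed.

Lemma rexp_others p (h : T -> R) (g : R * R -> R) : prime p ->
  bmeas (h : others p -> R) -> bmeas g ->
  rexp P (fun w => h w * g (plane (f p w))) =
  rexp P h * rexp P (fun w => g (plane (f p w))).
Proof.
move=> pp bh bg.
(* The first variable is the identity from [T] to the same set with the coarser sigma-algebra; its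
   law carries everything the [f q], [q <> p], can say. *)
apply: (@rexp_indep _ _ _ _ _ (others p) _ P (fun w => w)
  (fun w => plane (f p w))) => //.
- move=> _ A mA; rewrite setTI.
  exact: (others_measurable (mA : measurable (A : set (others p)))).
- exact: (steinhaus_measurable sf pp).
- by move=> A B mA mB; exact: others_indep.
Qed.

Lemma rexp_steinhaus p (g : R * R -> R) : prime p -> bmeas g ->
  rexp P (fun w => g (plane (f p w))) =
  rexp (uniform_prob (@pi2_gt0 R)) (fun x => g (plane (expi x))).
Proof.
move=> pp bg.
have mE : measurable_fun [set: measurableTypeR R]
    (fun x : measurableTypeR R => plane (expi (x : R))).
  exact: measurable_plane_expi.
pose E : {mfun measurableTypeR R >-> (R * R)%type} :=
  HB.pack (fun x : measurableTypeR R => plane (expi (x : R)))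
  (isMeasurableFun.Build _ _ _ _ _ mE).
pose Q : probability _ R := distribution (uniform_prob (@pi2_gt0 R)) E.
rewrite (rexp_law (Q := Q) (steinhaus_measurable sf pp) bg); last first.
  by move=> A mA; exact: (steinhaus_uniform sf pp mA).
by apply/esym; apply: (rexp_law (Q := Q) mE bg).
Qed.

(** This replaces the vanishing of the conditional expectation of [f p ^ k] given the other primes.
    Real and imaginary parts give four products of independent variables, each with a factor of mean
    zero. *)
Lemma cexp_others_eq0 p k (H : T -> R[i]) : prime p -> (0 < k)%N ->
  cbmeas (H : others p -> R[i]) ->
  cexpectation P (fun w => H w * clip (plane (f p w)) ^+ k) = 0.
Proof.
move=> pp k0 [bH cH].
have [bc cc] := cbmeasX k (@cbmeas_clip R).
have Re0 : rexp P (fun w => complex.Re (clip (plane (f p w)) ^+ k)) = 0.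
  apply: etrans (rexp_uniform_cos k0).
  rewrite (rexp_steinhaus pp bc); congr rexp.
  by apply/funext => x; rewrite clip_expi expiX.
have Im0 : rexp P (fun w => complex.Im (clip (plane (f p w)) ^+ k)) = 0.
  apply: etrans (rexp_uniform_sin k0).
  rewrite (rexp_steinhaus pp cc); congr rexp.
  by apply/funext => x; rewrite clip_expi expiX.
have bcP := bmeas_comp (steinhaus_measurable sf pp) bc.
have ccP := bmeas_comp (steinhaus_measurable sf pp) cc.
have bHT := others_bmeas bH; have cHT := others_bmeas cH.
rewrite cexpE.
under eq_fun do rewrite Re_mulc.
under [X in Complex _ (rexp _ X)]eq_fun do rewrite Im_mulc.
rewrite rexpB ?rexpD; [|exact: bmeasM..].
rewrite (rexp_others pp bH bc) (rexp_others pp cH cc).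
rewrite (rexp_others pp bH cc) (rexp_others pp cH bc).
by rewrite Re0 Im0 !mulr0 addr0 subrr.
Qed.

End independence.

Lemma cbmeas_comp {R : realType} {d d1 : measure_display}
    {T : measurableType d} {T1 : measurableType d1} (X : T -> T1)
    (h : T1 -> R[i]) :
  measurable_fun [set: T] X -> cbmeas h -> cbmeas (fun w => h (X w)).
Proof.
by move=> mX [bh ch]; split; [exact: bmeas_comp mX bh|exact: bmeas_comp mX ch].
Qed.

(** * An everywhere unimodular version of [f] *)

Section unimodular_version.
Context {R : realType} {d : measure_display} {T : measurableType d}.
Variables (P : probability T R) (f : nat -> T -> R[i]).
Hypothesis sf : steinhaus P f.
Variable K : nat.

Definition cf (q : nat) (w : T) : R[i] := clip (plane (f q w)).

(* Completely multiplicative, everywhere unimodular, and almost surely equal to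
   [f] at positive integers below [K]. *)
Definition ft (n : nat) (w : T) : R[i] :=
  \prod_(0 <= q < K | prime q) cf q w ^+ logn q n.

(** [ft] ignores primes from [K] on, so orthogonality can hold only for integers free of such
    primes. A mere bound [n < K] would not do: orthogonality is needed for products [m1 * m2], which
    may exceed [N] but stay smooth. *)
Definition smooth (n : nat) := (0 < n)%N && all (fun q => (q < K)%N) (primes n).

Lemma smoothM m n : smooth m -> smooth n -> smooth (m * n).
Proof.
move=> /andP[m0 /allP mK] /andP[n0 /allP nK]; rewrite /smooth muln_gt0 m0 n0/=.
by apply/allP => q; rewrite primesM// => /orP[/mK|/nK].
Qed.

Lemma ltn_smooth n : (0 < n < K)%N -> smooth n.
Proof.
move=> /andP[n0 nK]; rewrite /smooth n0/=; apply/allP => q.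
rewrite mem_primes => /and3P[_ _ /(dvdn_leq n0)] qn.
exact: leq_ltn_trans qn nK.
Qed.

Lemma ftM m n w : (0 < m)%N -> (0 < n)%N -> ft (m * n) w = ft m w * ft n w.
Proof.
move=> m0 n0; rewrite /ft -big_split/=; apply: eq_bigr => q _.
by rewrite lognM// exprD.
Qed.

Lemma cf_norm q w : cf q w * (cf q w)^*%C = 1.
Proof. exact: clip_norm. Qed.

Lemma ft_norm n w : ft n w * (ft n w)^*%C = 1.
Proof.
rewrite /ft rmorph_prod -big_split/= big1// => q _.
by rewrite rmorphXn/= -exprMn cf_norm expr1n.
Qed.

Lemma cbmeas_cf q : prime q -> cbmeas (cf q).
Proof.
by move=> qp; apply: cbmeas_comp (steinhaus_measurable sf qp) cbmeas_clip.
Qed.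

Lemma cbmeas_ft n : cbmeas (ft n).
Proof. by apply: cbmeas_prod => q qp; apply/cbmeasX/cbmeas_cf. Qed.

Lemma others_cf p q : prime q -> q != p -> cbmeas (cf q : others f p -> R[i]).
Proof.
move=> qp qnp.
apply: (@cbmeas_comp _ _ _ (others f p) _ (fun w => plane (f q w))).
  move=> _ C mC; rewrite setTI; apply: sub_sigma_algebra.
  exists [fset q]%fset, (fun=> C); split => //.
  - by move=> x; rewrite in_fset1 => /eqP ->; rewrite qp.
  - apply/seteqP; split=> w /=; first by move=> wC x; rewrite /= in_fset1 => /eqP ->.
    by apply; rewrite /= in_fset1.
exact: cbmeas_clip.
Qed.

Lemma others_ft p n : logn p n = 0%N -> cbmeas (ft n : others f p -> R[i]).
Proof.
move=> pn; apply: cbmeas_prod => q qp; have [->|qnp] := eqVneq q p.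
  by rewrite pn; exact: cbmeas_cst.
by apply: cbmeasX; exact: others_cf.
Qed.

Definition ftd p n w : R[i] :=
  \prod_(0 <= q < K | prime q && (q != p)) cf q w ^+ logn q n.

Lemma ftE p n w : prime p -> (p < K)%N ->
  ft n w = ftd p n w * cf p w ^+ logn p n.
Proof.
move=> pp pK; rewrite /ft /ftd !big_mkord mulrC.
by rewrite (bigD1 (Ordinal pK))//=.
Qed.

Lemma others_ftd p n : cbmeas (ftd p n : others f p -> R[i]).
Proof.
by apply: cbmeas_prod => q /andP[qp qnp]; apply: cbmeasX; exact: others_cf.
Qed.

Lemma cexp_others_ft p n (H : T -> R[i]) : prime p -> (p < K)%N ->
  (0 < logn p n)%N -> cbmeas (H : others f p -> R[i]) ->
  cexpectation P (fun w => H w * ft n w) = 0.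
Proof.
move=> pp pK pn bH.
under eq_cexp do rewrite (ftE _ _ pp pK) mulrA.
apply: (cexp_others_eq0 sf pp pn).
by apply: (cbmeasM bH); exact: others_ftd.
Qed.

Lemma cexp_others_ft_conj p n (H : T -> R[i]) : prime p -> (p < K)%N ->
  (0 < logn p n)%N -> cbmeas (H : others f p -> R[i]) ->
  cexpectation P (fun w => H w * (ft n w)^*%C) = 0.
Proof.
move=> pp pK pn bH.
have bHc := cbmeas_conj bH.
have bHT := others_cbmeas sf bHc.
have := cexp_others_ft pp pK pn bHc.
move/(congr1 (fun z => z^*%C)); rewrite -cexp_conj; last first.
  by apply: cbmeasM => //; exact: cbmeas_ft.
rewrite conjc0 => <-; apply: eq_cexp => w.
by rewrite rmorphM/= conjcK.
Qed.

(** The smaller power of [cf p] cancels against its conjugate by unimodularity; a positive power of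
    [cf p] remains, multiplied by a function of the other primes. *)
Lemma ft_orth_lt p m n : prime p -> (p < K)%N -> (logn p n < logn p m)%N ->
  cexpectation P (fun w => ft m w * (ft n w)^*%C) = 0.
Proof.
move=> pp pK nm.
under eq_cexp => w.
  rewrite !(ftE _ _ pp pK) -(subnK (ltnW nm)) exprD rmorphM/= rmorphXn/=.
  rewrite (_ : _ * _ * _ =
    ftd p m w * (ftd p n w)^*%C * cf p w ^+ (logn p m - logn p n) *
    (cf p w * (cf p w)^*%C) ^+ logn p n); last by rewrite exprMn; ring.
  rewrite cf_norm expr1n mulr1; over.
apply: (cexp_others_eq0 sf pp); first by rewrite subn_gt0.
by apply: cbmeasM; [|apply: cbmeas_conj]; exact: others_ftd.
Qed.

Lemma ft_orth m n : smooth m -> smooth n ->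
  cexpectation P (fun w => ft m w * (ft n w)^*%C) = (m == n)%:R.
Proof.
move=> sm sn; have [->|mn] := eqVneq m n.
  by under eq_cexp do rewrite ft_norm; rewrite cexp_cst.
have /andP[m0 /allP mK] := sm; have /andP[n0 /allP nK] := sn.
(* Distinct positive integers differ in some valuation, and smoothness places that prime below [K].
   The valuation may be larger on either side; conjugation exchanges the two cases. *)
have [p [pp pK pmn]] : exists p, [/\ prime p, (p < K)%N & logn p m != logn p n].
  apply: contrapT => H; move/eqP: mn; apply; apply: eqn_from_log => // p.
  have lt0 k : smooth k -> ~~ (prime p && (p < K)%N) -> logn p k = 0%N.
    move=> /andP[k0 /allP kK]; apply: contraNeq; rewrite -lt0n logn_gt0 => pk.
    by rewrite (kK p pk) andbT; move: pk; rewrite mem_primes => /and3P[].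
  have [/andP[pp pK]|npK] := boolP (prime p && (p < K)%N); last first.
    by rewrite !lt0.
  by apply/eqP/negPn/negP => pmn; apply: H; exists p.
move: pmn; rewrite neq_ltn => /orP[mn'|mn']; last exact: ft_orth_lt mn'.
have := ft_orth_lt pp pK mn'.
move/(congr1 (fun z => z^*%C)); rewrite -cexp_conj; last first.
  by apply: cbmeasM; [|apply: cbmeas_conj]; exact: cbmeas_ft.
rewrite conjc0 => h; apply: etrans h; apply: eq_cexp => w.
by rewrite rmorphM/= conjcK mulrC.
Qed.

Lemma ft_eq n w : (forall q, prime q -> (q < K)%N -> cf q w = f q w) ->
  (0 < n < K)%N -> ft n w = f n w.
Proof.
move=> cff; elim/ltn_ind: n => n IH /andP[n0 nK].
have [n1|] := leqP n 1%N.
  have -> : n = 1%N by apply/eqP; rewrite eqn_leq n1.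
  by rewrite (steinhaus1 sf) /ft big1// => q _; rewrite logn1.
move=> n1; have pp := pdiv_prime n1; have pn := pdiv_dvd n.
set p := pdiv n in pp pn.
have pK : (p < K)%N by apply: leq_ltn_trans nK; exact: dvdn_leq.
have [m nE] := dvdnP pn.
have m0 : (0 < m)%N by move: n0; rewrite nE muln_gt0 => /andP[].
have mn : (m < n)%N by rewrite nE ltn_Pmulr// prime_gt1.
have p0 := prime_gt0 pp.
rewrite [in LHS]nE ftM// [in RHS]nE (steinhausM sf)//.
rewrite IH//; last by rewrite m0 (ltn_trans mn).
congr (_ * _); rewrite (ftE _ _ pp pK) logn_prime// eqxx expr1 cff//.
rewrite /ftd big1 ?mul1r// => q /andP[qp qnp].
by rewrite logn_prime// (negbTE qnp).
Qed.

End unimodular_version.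

(** * The stopped product *)

Section stopped_product.
Context {R : realType}.
Implicit Types (x : nat -> R) (u s e : R) (z : R[i]).

Lemma cabs_ge0 z : 0 <= cabs z.
Proof. by case: z => a b; exact: sqrtr_ge0. Qed.

Lemma sqr_cabs z : cabs z ^+ 2 = complex.Re z ^+ 2 + complex.Im z ^+ 2.
Proof. by case: z => a b; rewrite sqr_sqrtr// addr_ge0// sqr_ge0. Qed.

Lemma cabs_le z (B : R) : 0 <= B ->
  complex.Re z ^+ 2 + complex.Im z ^+ 2 <= B ^+ 2 -> cabs z <= B.
Proof.
by move=> B0; rewrite -sqr_cabs ler_pXn2r// ?nnegrE ?cabs_ge0.
Qed.

Lemma ler_cabsD z1 z2 : cabs (z1 + z2) <= cabs z1 + cabs z2.
Proof. exact: le_normcD. Qed.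

Lemma cabsM z1 z2 : cabs (z1 * z2) = cabs z1 * cabs z2.
Proof. exact: ComplexField.Normc.normcM. Qed.

Lemma cabsN z : cabs (- z) = cabs z.
Proof. exact: normcN. Qed.

Lemma ler_cabs_ReIm z : cabs z <= `|complex.Re z| + `|complex.Im z|.
Proof.
apply: cabs_le; first by rewrite addr_ge0.
rewrite sqrrD !real_normK ?num_real// addrAC lerDl.
by rewrite mulrn_wge0// mulr_ge0.
Qed.

Lemma ler_Re_cabs z : `|complex.Re z| <= cabs z.
Proof.
rewrite -(@ler_pXn2r _ 2)// ?nnegrE ?cabs_ge0// sqr_cabs.
by rewrite real_normK ?num_real// lerDl sqr_ge0.
Qed.

Lemma ler_Im_cabs z : `|complex.Im z| <= cabs z.
Proof.
rewrite -(@ler_pXn2r _ 2)// ?nnegrE ?cabs_ge0// sqr_cabs.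
by rewrite real_normK ?num_real// lerDr sqr_ge0.
Qed.

Lemma cabs_real u : cabs u%:C%C = `|u|.
Proof. by rewrite /= expr0n/= addr0 sqrtr_sqr. Qed.

Lemma cabs_expi u : cabs (expi u) = 1.
Proof. by rewrite /= cos2Dsin2 sqrtr1. Qed.

(** The upper bound follows from [exp (-u) * (1 + u) <= 1] and
    [(1 + u) * (1 - u + u^2) = 1 + u^3]. *)
Lemma expR_taylor1 u : 0 <= u -> `|expR (- u) - (1 - u)| <= u ^+ 2.
Proof.
move=> u0; have h1 := expR_ge1Dx (- u); have h2 := expR_ge1Dx u.
have h3 : expR (- u) * expR u = 1 by rewrite -expRD addNr expR0.
have e0 := expR_gt0 (- u).
rewrite ler_norml; apply/andP; split; first by have := sqr_ge0 u; lra.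
have h4 : expR (- u) * (1 + u) <= 1 by rewrite -[leRHS]h3 ler_wpM2l// ltW.
have u3 : 0 <= u ^+ 3 by rewrite exprn_ge0.
rewrite lerBlDr -(@ler_pM2r _ (1 + u)); last by lra.
by apply: (le_trans h4); rewrite -subr_ge0 (_ : _ - _ = u ^+ 3); [|ring].
Qed.

(** The real parts agree through order [u^2] and, both being even, differ by [O(u^4)]; the imaginary
    parts agree to first order, which leaves [|u|^3]. *)
Lemma expi_approx u :
  cabs (expi u - Complex 1 u * (expR (- (u ^+ 2 / 2)))%:C%C) <=
  2 * u ^+ 4 + 2 * `|u| ^+ 3.
Proof.
have u2 : 0 <= u ^+ 2 / 2 by rewrite divr_ge0// sqr_ge0.
have hE := expR_taylor1 u2.
set E := expR _ in hE *.
apply: (le_trans (ler_cabs_ReIm _)). rewrite /= !mulr0 mul1r subr0 add0r.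
apply: lerD.
- rewrite (_ : cos u - E = (cos u - (1 - u ^+ 2 / 2)) - (E - (1 - u ^+ 2 / 2)));
    last by ring.
  apply: (le_trans (ler_normB _ _)); have := cos_taylor2 u.
  have : 0 <= u ^+ 4 by rewrite exprn_even_ge0.
  by move: hE; rewrite exprMn -exprM => hE; lra.
- rewrite (_ : sin u - u * E =
    (sin u - u) + u * ((1 - u ^+ 2 / 2 - E) + u ^+ 2 / 2)); last by ring.
  apply: (le_trans (ler_normD _ _)); have := sin_taylor1 u.
  suff : `|u * ((1 - u ^+ 2 / 2 - E) + u ^+ 2 / 2)| <= `|u| ^+ 3 by lra.
  rewrite normrM [(`|u| ^+ 3)]exprS ler_wpM2l// real_normK ?num_real//.
  rewrite (_ : 1 - u ^+ 2 / 2 - E + u ^+ 2 / 2 = 1 - E); last by ring.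
  have h1 := expR_ge1Dx (- (u ^+ 2 / 2)); rewrite -/E in h1.
  have h2 : E <= 1 by rewrite /E -[leRHS]expR0 ler_expR oppr_le0.
  by rewrite ger0_norm ?subr_ge0//; lra.
Qed.

Lemma cabs_1i_sqr u : cabs (Complex 1 u) ^+ 2 <= expR (u ^+ 2).
Proof. by rewrite sqr_cabs/= expr1n expR_ge1Dx. Qed.

Lemma cabs_damped u : cabs (Complex 1 u * (expR (- (u ^+ 2 / 2)))%:C%C) <= 1.
Proof.
rewrite cabsM cabs_real ger0_norm ?expR_ge0//.
rewrite -(@ler_pXn2r _ 2)// ?nnegrE ?mulr_ge0 ?cabs_ge0 ?expR_ge0//.
rewrite expr1n exprMn -expRM_natr.
have -> : - (u ^+ 2 / 2) * 2%:R = - u ^+ 2 by field.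
rewrite expRN ler_pdivrMr ?expR_gt0// mul1r; exact: cabs_1i_sqr.
Qed.

(** Factors are exchanged one at a time; since all of them have modulus at most 1, the individual
    errors simply add up. *)
Lemma expi_telescope x (z : nat -> R[i]) n : (forall i, cabs (z i) <= 1) ->
  cabs (expi (\sum_(i < n) x i) - \prod_(i < n) z i) <=
  \sum_(i < n) cabs (expi (x i) - z i).
Proof.
move=> z1; elim: n => [|n IH].
  by rewrite !big_ord0 expi0 subrr /= expr0n/= addr0 sqrtr0.
rewrite !big_ord_recr/= expiD.
set S := expi _ in IH *; set p := \prod_(_ < _) _ in IH *.
rewrite (_ : _ - _ = (S - p) * z n + S * (expi (x n) - z n)); last by ring.
apply: (le_trans (ler_cabsD _ _)); rewrite !cabsM /S cabs_expi mul1r lerD//.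
by apply: le_trans IH; rewrite ler_piMr ?cabs_ge0.
Qed.

Definition qvar x n : R := \sum_(i < n) x i ^+ 2.
Definition qquart x n : R := \sum_(i < n) x i ^+ 4.

(** Once the partial sum exceeds [2 s], all further factors are 1. The indicator at step [m]
    involves only [x i] with [i < m], so the stopping rule is predictable and the martingale
    property survives. *)
Fixpoint stopped s x n : R[i] :=
  if n is m.+1
  then stopped s x m * Complex 1 (x m * (qvar x m <= s *+ 2)%R%:R) else 1.

Lemma qvarS x n : qvar x n.+1 = qvar x n + x n ^+ 2.
Proof. by rewrite /qvar big_ord_recr. Qed.

Lemma qquartS x n : qquart x n.+1 = qquart x n + x n ^+ 4.
Proof. by rewrite /qquart big_ord_recr. Qed.

Lemma qquart_ge0 x n : 0 <= qquart x n.
Proof. by apply: sumr_ge0 => i _; rewrite exprn_even_ge0. Qed.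

Lemma stoppedE s x n : qvar x n <= s *+ 2 ->
  stopped s x n = \prod_(i < n) Complex 1 (x i).
Proof.
elim: n => [|n IH]; first by rewrite big_ord0.
rewrite qvarS => h; have h' : qvar x n <= s *+ 2.
  by apply: le_trans h; rewrite lerDl sqr_ge0.
by rewrite big_ord_recr/= h' mulr1 IH.
Qed.

(** Before the threshold is passed, [1 + x^2 <= exp (x^2)] multiplies up to [exp Q]. The factor that
    crosses it can be arbitrarily large; it is bounded by [1 + x^2 <= 2 + x^4], which brings in the
    quartic sum. Later factors are 1. *)
Lemma cabs_stopped_sqr s x n : 0 <= s -> cabs (stopped s x n) ^+ 2 <=
  if qvar x n <= s *+ 2 then expR (qvar x n)
  else expR (s *+ 2) * (2 + qquart x n).
Proof.
move=> s0; elim: n => [|n IH].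
  by rewrite /qvar big_ord0 mulrn_wge0//= expr0n/= addr0 sqrtr_sqr normr1 expr1n
    expR0.
have x2 := sqr_ge0 (x n); have x4 : 0 <= x n ^+ 4 by rewrite exprn_even_ge0.
rewrite [stopped _ _ _]/= cabsM exprMn qvarS qquartS.
have q0 := qquart_ge0 x n; have es := expR_gt0 (s *+ 2).
have [h|h] := boolP (qvar x n <= s *+ 2).
- rewrite h in IH *; rewrite mulr1; case: ifP => h'.
    by rewrite expRD ler_pM ?sqr_ge0 ?cabs_1i_sqr.
  rewrite ler_pM ?sqr_ge0//; first by apply: le_trans IH _; rewrite ler_expR.
  rewrite sqr_cabs/= expr1n; have := sqr_ge0 (x n ^+ 2 - 1).
  rewrite sqrrB -exprM expr1n mulr1; lra.
- rewrite (negbTE h) in IH *; rewrite mulr0.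
  have -> : (qvar x n + x n ^+ 2 <= s *+ 2) = false.
    apply/negbTE; move: h; rewrite -!ltNge => h; apply: lt_le_trans h _.
    by rewrite lerDl.
  rewrite [X in _ * X]sqr_cabs/= expr1n expr0n/= addr0 mulr1 (le_trans IH)//.
  by rewrite ler_pM2l// addrA lerDl.
Qed.

Lemma cabs_stopped s x n : 0 <= s ->
  cabs (stopped s x n) <= expR s * (2 + qquart x n).
Proof.
move=> s0; have q0 := qquart_ge0 x n; have es := expR_gt0 s.
rewrite -(@ler_pXn2r _ 2)// ?nnegrE ?cabs_ge0 ?mulr_ge0 ?expR_ge0//; last by lra.
apply: le_trans (cabs_stopped_sqr _ _ s0) _.
have -> : (expR s * (2 + qquart x n)) ^+ 2 =
    expR (s *+ 2) * (2 + qquart x n) ^+ 2 by rewrite exprMn -expRM_natr mulr_natr.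
have e2 := expR_gt0 (s *+ 2).
case: ifP => h.
- apply: (@le_trans _ _ (expR (s *+ 2) * 1)); first by rewrite mulr1 ler_expR.
  by rewrite ler_pM2l//; nra.
- by rewrite ler_pM2l//; nra.
Qed.

Lemma expR_sub1_le (v B : R) : 1 <= B -> expR v <= B -> `|1 - expR v| <= B * `|v|.
Proof.
move=> B1 vB; have h1 := expR_ge1Dx v; have h2 := expR_ge1Dx (- v).
have h3 : expR (- v) * expR v = 1 by rewrite -expRD addNr expR0.
have e0 := expR_gt0 v.
have [v0|v0] := leP 0 v.
- rewrite ler0_norm; last by rewrite subr_le0; lra.
  rewrite (ger0_norm v0) opprB.
  have : expR v * (1 - v) <= 1 by rewrite -[leRHS]h3 mulrC ler_wpM2r// ltW.
  have : expR v * v <= B * v by rewrite ler_wpM2r.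
  by lra.
- rewrite (ltr0_norm v0).
  have v1 : expR v <= 1 by rewrite -[leRHS]expR0 ler_expR ltW.
  by rewrite ger0_norm ?subr_ge0//; nra.
Qed.

(** A deterministic inequality that carries the whole analytic argument: its right side is affine in
    [(Q - s)^2] and the quartic sum, the only quantities whose means are controlled. The free
    parameter [e] is the arithmetic-geometric weight, later set to [eps]. *)
Lemma stopped_approx s x n e : 0 < s -> 0 < e -> e <= 1 ->
  cabs (expi (\sum_(i < n) x i) - stopped s x n * (expR (- s / 2))%:C%C) <=
  (4 * s * e + expR (s / 2) * s * e / 4) +
  expR (s / 2) * ((4 * s * e)^-1 + 3 / s ^+ 2) * (qvar x n - s) ^+ 2 +
  (4 / e + expR (s / 2)) * qquart x n.
Proof.
move=> s0 e0 e1; have W0 := qquart_ge0 x n.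
set Q := qvar x n; set W := qquart x n in W0 *.
have E1 : 1 <= expR (s / 2) by rewrite -[leLHS]expR0 ler_expR divr_ge0// ltW.
have es : 0 < s * e by rewrite mulr_gt0.
have ie1 : 1 <= e^-1 by rewrite invf_ge1.
have Es0 : 0 <= (Q - s) ^+ 2 by exact: sqr_ge0.
have i4 : 0 <= (4 * s * e)^-1 by rewrite invr_ge0; nra.
have i3 : 0 <= 3 / s ^+ 2 by rewrite divr_ge0// sqr_ge0.
(* For [Q > 2 s] both terms are bounded trivially by [1 + exp (s / 2) * (2 + W)]. Here
   [(Q - s)^2 / s^2 >= 1], so three copies of it, times [exp (s / 2)], pay for the constants. *)
have [h|h] := leP Q (s *+ 2); last first.
  apply: (le_trans (ler_cabsD _ _)); rewrite cabsN cabsM cabs_real cabs_expi.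
  rewrite ger0_norm ?expR_ge0//.
  have h1 := cabs_stopped x n (ltW s0).
  have h2 : cabs (stopped s x n) * expR (- s / 2) <= expR (s / 2) * (2 + W).
    apply: (le_trans (ler_wpM2r (expR_ge0 _) h1)).
    rewrite mulrAC -expRD; have -> : s + - s / 2 = s / 2 by field.
    by [].
  have h3 : 1 <= (Q - s) ^+ 2 / s ^+ 2.
    rewrite -expr_div_n -[leLHS](expr1n _ 2) lerXn2r ?nnegrE//.
      by rewrite divr_ge0 ?ltW//; lra.
    by rewrite ler_pdivlMr// mul1r; lra.
  have h4 : 0 <= 4 / e * W by rewrite mulr_ge0// divr_ge0// ltW.
  have h5 : 0 <= expR (s / 2) * (4 * s * e)^-1 * (Q - s) ^+ 2.
    by apply: mulr_ge0 => //; apply: mulr_ge0 => //; exact: expR_ge0.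
  have h6 : expR (s / 2) * 3 <= expR (s / 2) * (3 / s ^+ 2 * (Q - s) ^+ 2).
    rewrite ler_pM2l; last by lra.
    have -> : 3 / s ^+ 2 * (Q - s) ^+ 2 = 3 * ((Q - s) ^+ 2 / s ^+ 2) by ring.
    by lra.
  have h7 : 0 <= 4 * s * e by lra.
  have h8 : 0 <= expR (s / 2) * s * e / 4.
    by rewrite divr_ge0// -mulrA mulr_ge0 ?expR_ge0// ltW.
  by lra.
(* For [Q <= 2 s] nothing is stopped, and the product of these damped factors is the stopped product
   times [exp (- Q / 2)]. *)
pose z i := Complex 1 (x i) * (expR (- (x i ^+ 2 / 2)))%:C%C : R[i].
have zE : \prod_(i < n) z i =
    (\prod_(i < n) Complex 1 (x i)) * (expR (- (Q / 2)))%:C%C.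
  rewrite /z big_split/=; congr (_ * _).
  rewrite -rmorph_prod -expR_sum; congr (expR _)%:C%C.
  by rewrite sumrN -mulr_suml.
have h1 := @expi_telescope x z n (fun i => cabs_damped (x i)).
have h2 : \sum_(i < n) cabs (expi (x i) - z i) <= e * Q + 4 / e * W.
  rewrite /Q /W /qvar /qquart !mulr_sumr -big_split/=; apply: ler_sum => i _.
  apply: (le_trans (expi_approx _)).
  set u := x i; have u4 : 0 <= u ^+ 4 by rewrite exprn_even_ge0.
  (* The cubic error is split with weight [e]: the square parts sum to [e * Q], at most [2 s e] in
     this case, and the rest goes into the quartic sum. *)
  have : 2 * `|u| ^+ 3 <= e * u ^+ 2 + u ^+ 4 / e.
    have : 0 <= e * (`|u| - `|u| ^+ 2 / e) ^+ 2 by rewrite mulr_ge0 ?sqr_ge0// ltW.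
    have -> : e * (`|u| - `|u| ^+ 2 / e) ^+ 2 =
      e * `|u| ^+ 2 - 2 * `|u| ^+ 3 + (`|u| ^+ 2) ^+ 2 / e.
      by field; rewrite gt_eqF.
    by rewrite real_normK ?num_real// -exprM; lra.
  have : u ^+ 4 <= u ^+ 4 / e by rewrite ler_peMr.
  have -> : 4 / e * u ^+ 4 = 4 * (u ^+ 4 / e) by ring.
  by lra.
(* The product has modulus at most [exp (Q / 2)], which turns the difference of exponentials into
   [|1 - exp ((Q - s) / 2)|], whose exponent is at most [s / 2]. *)
have h3 : cabs (\prod_(i < n) z i - stopped s x n * (expR (- s / 2))%:C%C) <=
    expR (s / 2) * (`|Q - s| / 2).
  rewrite zE stoppedE// -mulrBr -rmorphB cabsM cabs_real.
  set p := \prod_(_ < _) _.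
  have hp : cabs p <= expR (Q / 2).
    rewrite -(@ler_pXn2r _ 2)// ?nnegrE ?cabs_ge0 ?expR_ge0// -expRM_natr.
    have -> : Q / 2 * 2%:R = Q by field.
    have := cabs_stopped_sqr x n (ltW s0); rewrite h.
    by rewrite stoppedE.
  apply: (le_trans (ler_wpM2r (normr_ge0 _) hp)).
  rewrite -[expR (Q / 2)]ger0_norm ?expR_ge0// -normrM mulrBr -!expRD subrr expR0.
  have -> : Q / 2 + - s / 2 = (Q - s) / 2 by field.
  have -> : `|Q - s| / 2 = `|(Q - s) / 2| by rewrite normrM [X in _ = _ * X]ger0_norm.
  by apply: expR_sub1_le => //; rewrite ler_expR; lra.
(* The weight [s * e] is scaled by [s] because [(Q - s)^2] has mean of order [s^2 e^2]. *)
have h4 : `|Q - s| / 2 <= (4 * s * e)^-1 * (Q - s) ^+ 2 + s * e / 4.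
  have : 0 <= (4 * s * e)^-1 * (`|Q - s| - s * e) ^+ 2.
    by rewrite mulr_ge0// sqr_ge0.
  rewrite sqrrB real_normK ?num_real// => h5.
  have : (4 * s * e)^-1 * (`|Q - s| * (s * e) *+ 2) = `|Q - s| / 2.
    by field; rewrite !gt_eqF.
  have : (4 * s * e)^-1 * (s * e) ^+ 2 = s * e / 4 by field; rewrite !gt_eqF.
  by move: h5; rewrite !mulrDr mulrN; lra.
have h5 : expR (s / 2) * (`|Q - s| / 2) <=
    expR (s / 2) * ((4 * s * e)^-1 * (Q - s) ^+ 2 + s * e / 4).
  by rewrite ler_pM2l//; lra.
have h6 : e * Q <= 2 * s * e by rewrite mulrC ler_pM2r//; lra.
have h7 : 0 <= expR (s / 2) * (3 / s ^+ 2) * (Q - s) ^+ 2.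
  by apply: mulr_ge0 => //; apply: mulr_ge0 => //; exact: expR_ge0.
have h8 : 0 <= expR (s / 2) * W by rewrite mulr_ge0 ?expR_ge0.
have -> : expi (\sum_(i < n) x i) - stopped s x n * (expR (- s / 2))%:C%C =
  (expi (\sum_(i < n) x i) - \prod_(i < n) z i) +
  (\prod_(i < n) z i - stopped s x n * (expR (- s / 2))%:C%C) by ring.
apply: (le_trans (ler_cabsD _ _)).
by have := le_trans h1 h2; lra.
Qed.

End stopped_product.

(** * Moments of the blocks *)

Section moments.
Context {R : realType} {d : measure_display} {T : measurableType d}.
Variables (P : probability T R) (f : nat -> T -> R[i]).
Hypothesis sf : steinhaus P f.
Variables (N : nat) (S : {fset nat}) (b : nat -> R[i]).
Hypothesis S_itv : forall n : nat, n \in S -> (2 <= n <= N)%N.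

Local Notation cE := (cexpectation P).
Local Notation phi := (ft f N.+1).

Definition cterm (n : nat) (w : T) : R[i] := b n * phi n w.

(** All [j <= N] serve as indices; blocks at non-primes are empty sums. The natural order of the
    indices is the time of the martingale. *)
Definition zblock (j : nat) (w : T) : R[i] :=
  \sum_(n <- S | max_pdiv n == j) cterm n w.

Lemma cbmeas_cterm n : cbmeas (cterm n).
Proof. by apply: cbmeasM; [exact: cbmeas_cst|exact: (cbmeas_ft sf)]. Qed.

Lemma cbmeas_zblock j : cbmeas (zblock j).
Proof. by apply: cbmeas_sum => n _; exact: cbmeas_cterm. Qed.

Lemma smooth_itv n : (0 < n <= N)%N -> smooth N.+1 n.
Proof. by move=> nN; apply: ltn_smooth; rewrite ltnS. Qed.

Lemma smoothS n : n \in S -> smooth N.+1 n.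
Proof. by move=> /S_itv/andP[n2 nN]; rewrite smooth_itv// (ltnW n2). Qed.

Lemma gt0S n : n \in S -> (0 < n)%N.
Proof. by move=> /S_itv/andP[n2 nN]; rewrite (ltnW n2). Qed.

Lemma max_pdiv_primeS n : n \in S -> prime (max_pdiv n).
Proof. by move=> /S_itv/andP[n2 _]; exact: max_pdiv_prime. Qed.

Lemma max_pdiv_ltS n : n \in S -> (max_pdiv n < N.+1)%N.
Proof.
move=> nS; have /andP[_ nN] := S_itv nS; rewrite ltnS (leq_trans _ nN)//.
by apply: dvdn_leq; [exact: gt0S|exact: max_pdiv_dvd].
Qed.

Lemma conj_mul_cabs (z : R[i]) : z * z^*%C = (cabs z ^+ 2)%:C%C.
Proof.
rewrite sqr_cabs; case: z => x y; apply/eqP; rewrite eq_complex/=.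
by rewrite mulrN opprK -!expr2 eqxx/= mulrN addrC mulrC subrr.
Qed.

Lemma conjcM (x y : R[i]) : (x * y)^*%C = x^*%C * y^*%C.
Proof. exact: rmorphM. Qed.

Lemma cexp_cterm_orth m n : smooth N.+1 m -> smooth N.+1 n ->
  cE (fun w => cterm m w * (cterm n w)^*%C) = b m * (b n)^*%C * (m == n)%:R.
Proof.
move=> sm sn; rewrite -(ft_orth sf sm sn) -cexpZ; last first.
  by apply: cbmeasM; [|apply: cbmeas_conj]; exact: (cbmeas_ft sf).
by apply: eq_cexp => w; rewrite /cterm rmorphM/=; ring.
Qed.

Lemma parseval (r : seq nat) : uniq r ->
  (forall n, n \in r -> smooth N.+1 n) ->
  rexp P (fun w => cabs (\sum_(n <- r) cterm n w) ^+ 2) =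
  \sum_(n <- r) cabs (b n) ^+ 2.
Proof.
move=> ur sr.
have bc m n : cbmeas (fun w => cterm m w * (cterm n w)^*%C).
  by apply: cbmeasM; [|apply: cbmeas_conj]; exact: cbmeas_cterm.
have -> : rexp P (fun w => cabs (\sum_(n <- r) cterm n w) ^+ 2) =
    complex.Re (cE (fun w => \sum_(m <- r) \sum_(n <- r)
      cterm m w * (cterm n w)^*%C)).
  rewrite cexpE/=; congr rexp; apply/funext => w.
  by rewrite -big_distrlr/= -rmorph_sum conj_mul_cabs.
rewrite cexp_sum; last by move=> m _; exact: cbmeas_sum.
rewrite raddf_sum; apply: eq_big_seq => m mr; rewrite cexp_sum//.
rewrite (bigD1_seq m)// big_seq_cond big1.
  by rewrite cexp_cterm_orth ?sr// eqxx mulr1 conj_mul_cabs /= addr0.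
move=> n /andP[nr nm]; rewrite cexp_cterm_orth ?sr//.
by rewrite eq_sym (negbTE nm) mulr0.
Qed.

Lemma rexp_le_cabs_cexp (F : T -> R) (G : T -> R[i]) (B : R) :
  (forall w, G w = (F w)%:C%C) -> cabs (cE G) <= B -> rexp P F <= B.
Proof.
move=> GF; apply: le_trans; have -> : rexp P F = complex.Re (cE G).
  by rewrite cexpE/=; congr rexp; apply/funext => w; rewrite GF.
by apply: le_trans (ler_norm _) (ler_Re_cabs _).
Qed.

(** Common form of the fourth-order quantities: [A] records which largest prime factors coincide.
    Taking the mean merely adds the condition [m1 * m2 = n1 * n2], which produces the sums of the
    hypotheses. *)
Definition quad (A : nat -> nat -> nat -> nat -> bool) (w : T) : R[i] :=
  \sum_(m1 <- S) \sum_(m2 <- S) \sum_(n1 <- S) \sum_(n2 <- S)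
    (A m1 m2 n1 n2)%:R *
    (cterm m1 w * cterm m2 w * (cterm n1 w * cterm n2 w)^*%C).

Lemma cexp_quad (A : nat -> nat -> nat -> nat -> bool) :
  cE (quad A) = \sum_(m1 <- S) \sum_(m2 <- S) \sum_(n1 <- S)
    \sum_(n2 <- S | (m1 * m2 == n1 * n2)%N && A m1 m2 n1 n2)
      b m1 * b m2 * ((b n1 * b n2)^*)%C.
Proof.
have bt m1 m2 n1 n2 : cbmeas (fun w => (A m1 m2 n1 n2)%:R *
    (cterm m1 w * cterm m2 w * (cterm n1 w * cterm n2 w)^*%C)).
  apply: cbmeasM; first exact: cbmeas_cst.
  by apply: cbmeasM; [|apply: cbmeas_conj]; apply: cbmeasM; exact: cbmeas_cterm.
have b1 m1 m2 n1 : cbmeas (fun w => \sum_(n2 <- S) (A m1 m2 n1 n2)%:R *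
    (cterm m1 w * cterm m2 w * (cterm n1 w * cterm n2 w)^*%C)).
  by apply: cbmeas_sum => n2 _; exact: bt.
have b2 m1 m2 : cbmeas (fun w => \sum_(n1 <- S) \sum_(n2 <- S)
    (A m1 m2 n1 n2)%:R *
    (cterm m1 w * cterm m2 w * (cterm n1 w * cterm n2 w)^*%C)).
  by apply: cbmeas_sum => n1 _; exact: b1.
rewrite cexp_sum; last by move=> m1 _; apply: cbmeas_sum => m2 _; exact: b2.
apply: eq_big_seq => m1 m1S; rewrite cexp_sum; last by move=> m2 _; exact: b2.
apply: eq_big_seq => m2 m2S; rewrite cexp_sum; last by move=> n1 _; exact: b1.
apply: eq_big_seq => n1 n1S; rewrite cexp_sum; last by move=> n2 _; exact: bt.
rewrite [RHS]big_mkcond; apply: eq_big_seq => n2 n2S.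
have := ft_orth sf (smoothM (smoothS m1S) (smoothS m2S))
  (smoothM (smoothS n1S) (smoothS n2S)).
set o := cexpectation _ _ => oE.
transitivity ((A m1 m2 n1 n2)%:R * (b m1 * b m2 * (b n1 * b n2)^*%C) * o).
  rewrite -cexpZ; last first.
    by apply: cbmeasM; [|apply: cbmeas_conj]; exact: (cbmeas_ft sf).
  apply: eq_cexp => w; rewrite /cterm !ftM ?gt0S// !rmorphM/=.
  by ring.
by rewrite oE; case: eqP => _; case: (A _ _ _ _) => /=;
  rewrite ?mulr1 ?mulr0 ?mul1r ?mul0r.
Qed.

Lemma zblockE j w :
  zblock j w = \sum_(n <- S) (max_pdiv n == j)%:R * cterm n w.
Proof.
rewrite /zblock big_mkcond; apply: eq_bigr => n _.
by case: ifP => _; rewrite ?mul1r ?mul0r.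
Qed.

Lemma sum_indicator (A : nat -> bool) n : n \in S ->
  \sum_(j < N.+1) (A j)%:R * (max_pdiv n == j)%:R = (A (max_pdiv n))%:R :> R[i].
Proof.
move=> nS; rewrite (bigD1 (Ordinal (max_pdiv_ltS nS)))//= eqxx mulr1.
rewrite big1 ?addr0// => j /eqP jn; case: eqP => [nj|_]; last by rewrite mulr0.
by exfalso; apply: jn; apply/val_inj.
Qed.

(** Summation over [j] turns membership of both integers in block [j] into equality of their largest
    primes. With [h] a term or its conjugate this yields the sum of [Z_p^2] or of [|Z_p|^2]. *)
Lemma sum_zblock2 (g h : nat -> T -> R[i]) w :
  \sum_(j < N.+1) (\sum_(m <- S) (max_pdiv m == j)%:R * g m w) *
    (\sum_(n <- S) (max_pdiv n == j)%:R * h n w) =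
  \sum_(m <- S) \sum_(n <- S) (max_pdiv m == max_pdiv n)%:R * (g m w * h n w).
Proof.
under eq_bigr do rewrite big_distrlr/=.
rewrite exchange_big; apply: eq_big_seq => m mS.
rewrite exchange_big; apply: eq_big_seq => n nS /=.
rewrite -(sum_indicator (fun j => max_pdiv m == j) nS) mulr_suml.
by apply: eq_bigr => j _; ring.
Qed.

Lemma sum_zblock_sqr w : \sum_(j < N.+1) zblock j w ^+ 2 =
  \sum_(m <- S) \sum_(n <- S)
    (max_pdiv m == max_pdiv n)%:R * (cterm m w * cterm n w).
Proof.
by rewrite -sum_zblock2; apply: eq_bigr => j _; rewrite expr2 !zblockE.
Qed.

Lemma zblock_conj j w : (zblock j w)^*%C =
  \sum_(n <- S) (max_pdiv n == j)%:R * (cterm n w)^*%C.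
Proof.
rewrite zblockE rmorph_sum/=; apply: eq_bigr => n _.
by rewrite rmorphM/= conjc_nat.
Qed.

Lemma sum_zblock_norm w : (\sum_(j < N.+1) cabs (zblock j w) ^+ 2)%:C%C =
  \sum_(m <- S) \sum_(n <- S)
    (max_pdiv m == max_pdiv n)%:R * (cterm m w * (cterm n w)^*%C).
Proof.
rewrite -(sum_zblock2 cterm (fun n w => (cterm n w)^*%C)) rmorph_sum/=.
by apply: eq_bigr => j _; rewrite -conj_mul_cabs zblock_conj zblockE.
Qed.

Lemma quad_same_sides w :
  ((cabs (\sum_(j < N.+1) zblock j w ^+ 2)) ^+ 2)%:C%C =
  quad (fun m1 m2 n1 n2 => (max_pdiv m1 == max_pdiv m2) &&
                           (max_pdiv n1 == max_pdiv n2)) w.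
Proof.
rewrite -conj_mul_cabs sum_zblock_sqr mulr_suml; apply: eq_bigr => m1 _.
rewrite mulr_suml; apply: eq_bigr => m2 _.
rewrite rmorph_sum/= mulr_sumr; apply: eq_bigr => n1 _.
rewrite rmorph_sum/= mulr_sumr; apply: eq_bigr => n2 _.
by rewrite rmorphM/= conjc_nat -mulnb natrM; ring.
Qed.

Lemma quad_same_pairs w :
  ((\sum_(j < N.+1) cabs (zblock j w) ^+ 2) ^+ 2)%:C%C =
  quad (fun m1 m2 n1 n2 => (max_pdiv m1 == max_pdiv n1) &&
                           (max_pdiv m2 == max_pdiv n2)) w.
Proof.
rewrite rmorphXn/= sum_zblock_norm expr2 mulr_suml; apply: eq_bigr => m1 _.
rewrite mulr_suml.
under eq_bigr do rewrite mulr_sumr.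
rewrite exchange_big; apply: eq_bigr => m2 _; apply: eq_bigr => n1 _ /=.
rewrite mulr_sumr; apply: eq_bigr => n2 _.
by rewrite (conjcM (cterm n1 w)) -mulnb natrM; ring.
Qed.

Lemma quad_all_same w :
  (\sum_(j < N.+1) cabs (zblock j w) ^+ 4)%:C%C =
  quad (fun m1 m2 n1 n2 => [&& max_pdiv m1 == max_pdiv n1,
    max_pdiv n1 == max_pdiv m2 & max_pdiv m2 == max_pdiv n2]) w.
Proof.
rewrite rmorph_sum/=.
(* The indicator of [n2] is kept apart: once the sum over [j] is innermost, it selects the single
   index [j = max_pdiv n2]. *)
transitivity (\sum_(j < N.+1) \sum_(m1 <- S) \sum_(m2 <- S) \sum_(n1 <- S)
    \sum_(n2 <- S) ([&& max_pdiv m1 == j, max_pdiv m2 == j & max_pdiv n1 == j]%:R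
      * (max_pdiv n2 == j)%:R) *
    (cterm m1 w * cterm m2 w * (cterm n1 w * cterm n2 w)^*%C)).
  apply: eq_bigr => j _.
  rewrite -[4%N]/(2 * 2)%N exprM rmorphXn/= -conj_mul_cabs zblock_conj zblockE.
  rewrite exprMn expr2 mulr_suml mulr_suml; apply: eq_bigr => m1 _.
  rewrite mulr_sumr mulr_suml; apply: eq_bigr => m2 _.
  rewrite expr2 mulr_suml mulr_sumr; apply: eq_bigr => n1 _.
  rewrite !mulr_sumr; apply: eq_bigr => n2 _.
  by rewrite (conjcM (cterm n1 w)) -!mulnb !natrM; ring.
rewrite exchange_big; apply: eq_big_seq => m1 m1S.
rewrite exchange_big; apply: eq_big_seq => m2 m2S.
rewrite exchange_big; apply: eq_big_seq => n1 n1S.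
rewrite exchange_big; apply: eq_big_seq => n2 n2S /=.
rewrite -mulr_suml (sum_indicator (fun j =>
  [&& max_pdiv m1 == j, max_pdiv m2 == j & max_pdiv n1 == j]) n2S).
congr (_%:R * _); congr nat_of_bool.
apply/and3P/and3P => -[/eqP e1 /eqP e2 /eqP e3].
  by rewrite e1 e2 e3 !eqxx.
by rewrite e1 e2 e3 !eqxx.
Qed.

End moments.

Section moment_bounds.
Context {R : realType} {d : measure_display} {T : measurableType d}.
Variables (P : probability T R) (f : nat -> T -> R[i]).
Hypothesis sf : steinhaus P f.
Variables (N : nat) (S : {fset nat}) (b : nat -> R[i]).
Hypothesis S_itv : forall n : nat, n \in S -> (2 <= n <= N)%N.

Local Notation cE := (cexpectation P).
Local Notation K := N.+1.
Local Notation z := (zblock f N S b).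

Lemma bmeas_cabs2 (F : T -> R[i]) : cbmeas F -> bmeas (fun w => cabs (F w) ^+ 2).
Proof.
move=> [bF cF]; under eq_fun do rewrite sqr_cabs.
by apply: bmeasD; exact: bmeasX.
Qed.

Let bz j : cbmeas (z j).
Proof. exact: (cbmeas_zblock sf). Qed.

Lemma bmeas_znorm2 : bmeas (fun w => \sum_(j < K) cabs (z j w) ^+ 2).
Proof. by apply: bmeas_sum => j _; exact: bmeas_cabs2. Qed.

Lemma bmeas_znorm4 : bmeas (fun w => \sum_(j < K) cabs (z j w) ^+ 4).
Proof.
apply: bmeas_sum => j _; under eq_fun do rewrite -[4%N]/(2 * 2)%N exprM.
by apply: bmeasX; exact: bmeas_cabs2.
Qed.

Lemma bmeas_zsqr : bmeas (fun w => cabs (\sum_(j < K) z j w ^+ 2) ^+ 2).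
Proof. by apply: bmeas_cabs2; apply: cbmeas_sum => j _; exact: cbmeasX. Qed.

Section given_bounds.
Variable e : R.
Hypothesis H2 : cabs (\sum_(m1 <- S) \sum_(m2 <- S) \sum_(n1 <- S)
        \sum_(n2 <- S | [&& (m1 * m2 == n1 * n2)%N, m1 != n1, m2 != n2,
                            max_pdiv m1 == max_pdiv n1
                          & max_pdiv m2 == max_pdiv n2])
          b m1 * b m2 * ((b n1 * b n2)^*)%C) <= e ^+ 2.
Hypothesis H3 : cabs (\sum_(m1 <- S) \sum_(m2 <- S) \sum_(n1 <- S)
        \sum_(n2 <- S | [&& (m1 * m2 == n1 * n2)%N,
                            max_pdiv m1 == max_pdiv n1,
                            max_pdiv n1 == max_pdiv m2
                          & max_pdiv m2 == max_pdiv n2])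
          b m1 * b m2 * ((b n1 * b n2)^*)%C) <= e ^+ 4.

Lemma rexp_znorm4 : rexp P (fun w => \sum_(j < K) cabs (z j w) ^+ 4) <= e ^+ 4.
Proof.
apply: (rexp_le_cabs_cexp (fun w => esym (quad_all_same f b S_itv w))).
by rewrite (cexp_quad sf).
Qed.

(** The largest prime of [m1] divides [n1 * n2], hence one of two integers sharing the same largest
    prime. Used in both directions, it makes all four largest primes equal, so that [rexp_zsqr]
    reduces to [H3]. *)
Lemma max_pdiv_prod_le m1 m2 n1 n2 : m1 \in S -> n1 \in S -> n2 \in S ->
  (m1 * m2 = n1 * n2)%N ->
  max_pdiv n1 = max_pdiv n2 -> (max_pdiv m1 <= max_pdiv n1)%N.
Proof.
move=> m1S n1S n2S mn en.
have pp := max_pdiv_primeS S_itv m1S.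
have : (max_pdiv m1 %| n1 * n2)%N.
  by rewrite -mn dvdn_mulr// max_pdiv_dvd.
rewrite Euclid_dvdM// => /orP[|] pn; last rewrite en.
  by apply: max_pdiv_max; rewrite mem_primes pp pn (gt0S S_itv n1S).
by apply: max_pdiv_max; rewrite mem_primes pp pn (gt0S S_itv n2S).
Qed.

Lemma rexp_zsqr :
  rexp P (fun w => cabs (\sum_(j < K) z j w ^+ 2) ^+ 2) <= e ^+ 4.
Proof.
apply: (rexp_le_cabs_cexp (fun w => esym (quad_same_sides f b S_itv w))).
rewrite (cexp_quad sf)//; apply: le_trans H3; rewrite le_eqVlt; apply/orP; left.
apply/eqP; congr cabs.
apply: eq_big_seq => m1 m1S; apply: eq_big_seq => m2 m2S.
apply: eq_big_seq => n1 n1S; rewrite big_seq_cond [RHS]big_seq_cond.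
apply: eq_bigl => n2; have [n2S|//] := boolP (n2 \in S).
rewrite /=; case: eqP => //= mn.
apply/andP/and3P => [[/eqP em /eqP en]|[/eqP e1 /eqP e2 /eqP e3]]; last first.
  by rewrite e1 e2 e3 !eqxx.
have e1 : max_pdiv m1 = max_pdiv n1.
  apply/eqP; rewrite eqn_leq; apply/andP; split.
    exact: max_pdiv_prod_le mn en.
  exact: max_pdiv_prod_le (esym mn) em.
by rewrite -em -en e1 !eqxx.
Qed.

Local Notation v := (\sum_(n <- S) cabs (b n) ^+ 2).

Lemma rexp_znorm2 : rexp P (fun w => \sum_(j < K) cabs (z j w) ^+ 2) = v.
Proof.
have bc m n : cbmeas (fun w => (max_pdiv m == max_pdiv n)%:R *
    (cterm f N b m w * (cterm f N b n w)^*%C)).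
  apply: cbmeasM; first exact: cbmeas_cst.
  by apply: cbmeasM; [|apply: cbmeas_conj]; exact: (cbmeas_cterm sf).
transitivity (complex.Re (cE (fun w =>
    (\sum_(j < K) cabs (z j w) ^+ 2)%:C%C))); first by [].
under eq_cexp do rewrite (sum_zblock_norm f b S_itv).
rewrite cexp_sum; last by move=> m _; exact: cbmeas_sum.
rewrite raddf_sum; apply: eq_big_seq => m mS; rewrite cexp_sum//.
rewrite (bigD1_seq m)// big_seq_cond big1.
  rewrite eqxx; under eq_cexp do rewrite mul1r.
  rewrite (cexp_cterm_orth sf) ?(smoothS S_itv)//.
  by rewrite eqxx mulr1 conj_mul_cabs /= addr0.
move=> n /andP[nS nm]; rewrite cexpZ; last first.
  by apply: cbmeasM; [|apply: cbmeas_conj]; exact: (cbmeas_cterm sf).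
rewrite (cexp_cterm_orth sf) ?(smoothS S_itv)//.
by rewrite [m == n]eq_sym (negbTE nm) !mulr0.
Qed.

Lemma diag_sum : \sum_(m1 <- S) \sum_(m2 <- S) \sum_(n1 <- S)
    \sum_(n2 <- S | ((m1 * m2 == n1 * n2)%N && ((max_pdiv m1 == max_pdiv n1)
       && (max_pdiv m2 == max_pdiv n2))) && (m1 == n1))
      b m1 * b m2 * ((b n1 * b n2)^*)%C = (v ^+ 2)%:C%C.
Proof.
rewrite expr2 mulr_suml rmorph_sum/=; apply: eq_big_seq => m1 m1S.
rewrite mulr_sumr rmorph_sum/=; apply: eq_big_seq => m2 m2S.
have uS := fset_uniq S.
rewrite (bigD1_seq m1)//= [X in _ + X]big1 ?addr0; last first.
  by move=> n1 nm; rewrite big1// => n2; rewrite [m1 == n1]eq_sym (negbTE nm) andbF.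
rewrite -(big_filter S) (_ : [seq _ <- _ | _] = [:: m2]).
  by rewrite big_seq1 conj_mul_cabs cabsM exprMn.
have -> : [seq n2 <- S | ((m1 * m2 == m1 * n2)%N && ((max_pdiv m1 == max_pdiv m1)
       && (max_pdiv m2 == max_pdiv n2))) && (m1 == m1)] =
    [seq n2 <- S | n2 == m2].
  apply: eq_filter => n2; rewrite !eqxx andbT /=.
  rewrite eqn_pmul2l ?(gt0S S_itv m1S)// eq_sym.
  by case: eqP => // ->; rewrite eqxx.
by rewrite filter_pred1_uniq.
Qed.

(** The quadruples are split by [m1 = n1]. Under [m1 m2 = n1 n2] this is equivalent to [m2 = n2], so
    one part is the diagonal [v^2] and the other is exactly the sum in [H2]. *)
Lemma rexp_znorm2_sqr :
  rexp P (fun w => (\sum_(j < K) cabs (z j w) ^+ 2) ^+ 2) <= v ^+ 2 + e ^+ 2.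
Proof.
apply: (rexp_le_cabs_cexp (fun w => esym (quad_same_pairs f b S_itv w))).
rewrite (cexp_quad sf)//.
under eq_bigr => m1 _.
  under eq_bigr => m2 _.
    under eq_bigr => n1 _.
      rewrite (bigID (fun=> m1 == n1))/=.
      over.
    rewrite big_split/=; over.
  rewrite big_split/=; over.
rewrite big_split/= diag_sum; apply: (le_trans (ler_cabsD _ _)).
rewrite cabs_real ger0_norm ?sqr_ge0// lerD2l.
apply: le_trans H2; rewrite le_eqVlt; apply/orP; left; apply/eqP; congr cabs.
apply: eq_big_seq => m1 m1S; apply: eq_big_seq => m2 m2S.
apply: eq_big_seq => n1 n1S; rewrite big_seq_cond [RHS]big_seq_cond.
apply: eq_bigl => n2; have [n2S|//] := boolP (n2 \in S).
rewrite /=; case: eqP => //= mn.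
have [->|mn1] := eqVneq m1 n1; rewrite ?andbF//= ?andbT.
suff -> : m2 != n2 by [].
apply: contra mn1 => /eqP mn2; move/eqP: mn; rewrite mn2.
by rewrite eqn_pmul2r// (gt0S S_itv n2S).
Qed.

(** Expanding the square gives at most [(v^2 + e^2) - 2 v + 1 = (1 - v)^2 + e^2], and [1 - v] is the
    mass lost outside [S]. *)
Lemma rexp_znorm2_dev : 1 - e ^+ 2 <= v -> v <= 1 ->
  rexp P (fun w => (\sum_(j < K) cabs (z j w) ^+ 2 - 1) ^+ 2) <= e ^+ 2 + e ^+ 4.
Proof.
move=> v1 v2; set y := fun w => \sum_(j < K) cabs (z j w) ^+ 2.
have by_ : bmeas y := bmeas_znorm2.
have -> : rexp P (fun w => (y w - 1) ^+ 2) =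
    rexp P (fun w => y w ^+ 2 + ((- 2) * y w + 1)).
  by congr rexp; apply/funext => w; ring.
have by2 : bmeas (fun w => y w ^+ 2) by exact: bmeasX.
have by1 : bmeas (fun w => -2 * y w).
  by apply: bmeasM => //; exact: bmeas_cst.
rewrite rexpD//; last by apply: bmeasD => //; exact: bmeas_cst.
rewrite rexpD ?rexpZ ?rexp_cst//; last exact: bmeas_cst.
rewrite rexp_znorm2; have := rexp_znorm2_sqr; rewrite -/y => h.
have h2 : (1 - v) ^+ 2 <= e ^+ 4.
  rewrite -[4%N]/(2 * 2)%N exprM lerXn2r ?nnegrE ?sqr_ge0//; lra.
by move: h2; rewrite sqrrB expr1n mul1r -mulr_natr; lra.
Qed.

End given_bounds.
End moment_bounds.

(** * The martingale *)

Section martingale.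
Context {R : realType} {d : measure_display} {T : measurableType d}.
Variables (P : probability T R) (f : nat -> T -> R[i]).
Hypothesis sf : steinhaus P f.
Variables (N : nat) (S : {fset nat}) (b : nat -> R[i]).
Hypothesis S_itv : forall n : nat, n \in S -> (2 <= n <= N)%N.
Variables t1 t2 : R.

Local Notation cE := (cexpectation P).
Local Notation K := N.+1.
Local Notation z := (zblock f N S b).
Local Notation s := ((t1 ^+ 2 + t2 ^+ 2) / 2).

Definition xblock (w : T) (j : nat) : R :=
  t1 * complex.Re (z j w) + t2 * complex.Im (z j w).

(** An integer with largest prime [j < p] is not divisible by [p]: earlier blocks do not see
    [f p]. *)
Lemma others_zblock j p : (j < p)%N -> cbmeas (z j : others f p -> R[i]).
Proof.
move=> jp; apply: cbmeas_sum => n /eqP nj; apply: cbmeasM.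
  exact: cbmeas_cst.
apply: (others_ft _ (T := T)); apply/eqP; rewrite -leqn0 leqNgt.
apply: contraTN jp; rewrite logn_gt0 -leqNgt -nj; exact: max_pdiv_max.
Qed.

Lemma others_xblock j p : (j < p)%N ->
  bmeas ((fun w => xblock w j) : others f p -> R).
Proof.
move=> /others_zblock[bz cz].
by apply: bmeasD; apply: bmeasM => //; exact: bmeas_cst.
Qed.

Lemma others_qvar j p : (j <= p)%N ->
  bmeas ((fun w => qvar (xblock w) j) : others f p -> R).
Proof.
move=> jp; apply: bmeas_sum => i _; apply: bmeasX; apply: others_xblock.
exact: leq_trans (ltn_ord i) jp.
Qed.

(** The product of length [j] uses blocks of index below [j] only, so [p = j] is allowed; the
    martingale step uses exactly this case. *)
Lemma others_stopped j p : (j <= p)%N ->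
  cbmeas ((fun w => stopped s (xblock w) j) : others f p -> R[i]).
Proof.
elim: j => [|j IH] jp; first exact: cbmeas_cst.
apply: cbmeasM; first by apply: IH; exact: ltnW.
split; first exact: bmeas_cst.
apply: bmeasM; first exact: others_xblock.
by apply: bmeas_le; apply: others_qvar; exact: ltnW.
Qed.

(** Every integer of block [j] is divisible by [j], so each term carries a positive power of [cf j].
    The conjugate is treated as well because the real increment combines [z j] with its
    conjugate. *)
Lemma cexp_others_zblock j (H : T -> R[i]) : cbmeas (H : others f j -> R[i]) ->
  cE (fun w => H w * z j w) = 0 /\ cE (fun w => H w * (z j w)^*%C) = 0.
Proof.
move=> bH; have bHT := others_cbmeas sf bH.
have key n : n \in S -> max_pdiv n = j -> [/\ prime j, (j < K)%N & (0 < logn j n)%N].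
  move=> nS <-; split.
  - exact: (max_pdiv_primeS S_itv).
  - exact: (max_pdiv_ltS S_itv).
  - rewrite logn_gt0 mem_primes (max_pdiv_primeS S_itv)// max_pdiv_dvd.
    by rewrite (gt0S S_itv).
split.
- transitivity (\sum_(n <- S | max_pdiv n == j)
    cE (fun w => H w * cterm f N b n w)).
    rewrite -cexp_sum; first by apply: eq_cexp => w; rewrite mulr_sumr.
    by move=> n _; apply: cbmeasM => //; exact: (cbmeas_cterm sf).
  rewrite big_seq_cond big1// => n /andP[nS /eqP nj].
  have [jp jK jn] := key n nS nj.
  have bHb : cbmeas ((fun w => H w * b n) : others f j -> R[i]).
    by apply: (cbmeasM bH); exact: cbmeas_cst.
  rewrite -(cexp_others_ft sf jp jK jn bHb); apply: eq_cexp => w.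
  by rewrite /cterm mulrA.
- transitivity (\sum_(n <- S | max_pdiv n == j)
    cE (fun w => H w * (cterm f N b n w)^*%C)).
    rewrite -cexp_sum; first by apply: eq_cexp => w; rewrite rmorph_sum/= mulr_sumr.
    move=> n _; apply: cbmeasM => //; apply: cbmeas_conj.
    exact: (cbmeas_cterm sf).
  rewrite big_seq_cond big1// => n /andP[nS /eqP nj].
  have [jp jK jn] := key n nS nj.
  have bHb : cbmeas ((fun w => H w * (b n)^*%C) : others f j -> R[i]).
    by apply: (cbmeasM bH); exact: cbmeas_cst.
  rewrite -(cexp_others_ft_conj sf jp jK jn bHb); apply: eq_cexp => w.
  by rewrite /cterm conjcM mulrA.
Qed.

(* The martingale property: the factor indexed by [j] has conditional
   expectation 1 given the [f q], [q <> j]. *)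
Lemma cexp_stopped j : cE (fun w => stopped s (xblock w) j) = 1.
Proof.
elim: j => [|j IH]; first by rewrite cexp_cst.
have bst := others_stopped (leqnn j).
have bstT := others_cbmeas sf bst.
(* With this [c] the increment is [xblock w j = c * z + conj c * conj z]. *)
pose c : R[i] := Complex (t1 / 2) (- (t2 / 2)).
pose H w : R[i] := 'i%C * stopped s (xblock w) j *
  ((qvar (xblock w) j <= s *+ 2)%R%:R)%:C%C.
have bH : cbmeas (H : others f j -> R[i]).
  apply: cbmeasM; first by apply: (cbmeasM (cbmeas_cst _)).
  by apply: cbmeas_real; apply: bmeas_le; exact: others_qvar.
have bHT := others_cbmeas sf bH.
have [H1 H2] := cexp_others_zblock bH.
have bz : cbmeas (z j) by exact: (cbmeas_zblock sf).
transitivity (cE (fun w => stopped s (xblock w) j +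
   (c * (H w * z j w) + c^*%C * (H w * (z j w)^*%C)))).
  apply: eq_cexp => w; rewrite [stopped _ _ _.+1]/=.
  have -> : Complex 1 (xblock w j * (qvar (xblock w) j <= s *+ 2)%R%:R) =
    1 + 'i%C * ((qvar (xblock w) j <= s *+ 2)%R%:R)%:C%C *
      (c * z j w + c^*%C * (z j w)^*%C).
    rewrite /xblock /c; case: (z j w) => x y.
    by apply/eqP; rewrite eq_complex/=; apply/andP; split; apply/eqP; field.
  by rewrite /H; ring.
rewrite cexpD//; last first.
  by apply: cbmeasD; apply: (cbmeasM (cbmeas_cst _)); apply: (cbmeasM bHT) => //;
    exact: cbmeas_conj.
rewrite IH cexpD; last 2 first.
- by apply: (cbmeasM (cbmeas_cst _)); apply: (cbmeasM bHT).
- by apply: (cbmeasM (cbmeas_cst _)); apply: (cbmeasM bHT); exact: cbmeas_conj.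
rewrite !cexpZ ?H1 ?H2 ?mulr0 ?addr0//.
- by apply: (cbmeasM bHT); exact: cbmeas_conj.
- exact: (cbmeasM bHT).
Qed.

Lemma bmeas_xblock j : bmeas (fun w => xblock w j).
Proof.
have [bz cz] : cbmeas (z j) by exact: (cbmeas_zblock sf).
by apply: bmeasD; apply: bmeasM => //; exact: bmeas_cst.
Qed.

Lemma bmeas_qvar j : bmeas (fun w => qvar (xblock w) j).
Proof. by apply: bmeas_sum => i _; apply: bmeasX; exact: bmeas_xblock. Qed.

Lemma bmeas_qquart j : bmeas (fun w => qquart (xblock w) j).
Proof. by apply: bmeas_sum => i _; apply: bmeasX; exact: bmeas_xblock. Qed.

Lemma qvar_dev w : (qvar (xblock w) K - s) ^+ 2 <=
  2 * s ^+ 2 * ((\sum_(j < K) cabs (z j w) ^+ 2 - 1) ^+ 2 +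
                cabs (\sum_(j < K) z j w ^+ 2) ^+ 2).
Proof.
set y := \sum_(j < K) _; set B := \sum_(j < K) z j w ^+ 2.
pose D := (t1 ^+ 2 - t2 ^+ 2) * complex.Re B + 2 * t1 * t2 * complex.Im B.
have QE : qvar (xblock w) K = s * y + D / 2.
  rewrite /qvar /D /B !raddf_sum !mulr_sumr -big_split/= mulr_suml -big_split/=.
  apply: eq_bigr => j _; rewrite sqr_cabs /xblock; case: (z j w) => x u /=.
  by field.
rewrite sqr_cabs QE.
set p := complex.Re B; set q := complex.Im B.
have -> : s * y + D / 2 - s = s * (y - 1) + D / 2 by ring.
have hD : D ^+ 2 <= 4 * s ^+ 2 * (p ^+ 2 + q ^+ 2).
  rewrite -subr_ge0.
  rewrite (_ : _ - _ = ((t1 ^+ 2 - t2 ^+ 2) * q - 2 * t1 * t2 * p) ^+ 2).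
    exact: sqr_ge0.
  by rewrite /D -/p -/q; field.
set a := s * (y - 1).
have h : (a + D / 2) ^+ 2 <= 2 * a ^+ 2 + D ^+ 2 / 2.
  rewrite -subr_ge0 (_ : _ - _ = (a - D / 2) ^+ 2) ?sqr_ge0//.
  by field.
rewrite (_ : 2 * s ^+ 2 * _ = 2 * a ^+ 2 + 2 * s ^+ 2 * (p ^+ 2 + q ^+ 2)).
  by lra.
by rewrite /a; ring.
Qed.

Lemma qquart_le w : qquart (xblock w) K <=
  4 * s ^+ 2 * \sum_(j < K) cabs (z j w) ^+ 4.
Proof.
rewrite mulr_sumr; apply: ler_sum => j _.
rewrite -[4%N]/(2 * 2)%N !exprM sqr_cabs /xblock; case: (z j w) => x y /=.
have -> : 4 * s ^+ 2 * (x ^+ 2 + y ^+ 2) ^+ 2 =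
  ((t1 ^+ 2 + t2 ^+ 2) * (x ^+ 2 + y ^+ 2)) ^+ 2 by field.
rewrite lerXn2r ?nnegrE ?sqr_ge0//; first by rewrite mulr_ge0// addr_ge0// sqr_ge0.
rewrite -subr_ge0 (_ : _ - _ = (t1 * y - t2 * x) ^+ 2); last by ring.
exact: sqr_ge0.
Qed.

End martingale.

(** * The central limit theorem *)

(** The coordinates are bounded separately, which costs the factor 2 but needs only monotonicity of
    the real expectation. *)
Lemma ler_cabs_cexp {R : realType} {d : measure_display} {T : measurableType d}
    (P : probability T R) (F : T -> R[i]) (B : T -> R) :
  cbmeas F -> bmeas B -> (forall w, cabs (F w) <= B w) ->
  cabs (cexpectation P F) <= 2 * rexp P B.
Proof.
move=> [bF cF] bB FB; apply: (le_trans (ler_cabs_ReIm _)).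
rewrite mulr_natl mulr2n; apply: lerD.
- apply: (ler_norm_rexp P bF bB) => w; exact: le_trans (ler_Re_cabs _) (FB w).
- apply: (ler_norm_rexp P cF bB) => w; exact: le_trans (ler_Im_cabs _) (FB w).
Qed.

Lemma expi_lip {R : realType} (x y : R) :
  cabs (expi x - expi y) <= 2 * `|x - y|.
Proof.
apply: (le_trans (ler_cabs_ReIm _)); rewrite mulr_natl mulr2n /=.
by apply: lerD; [exact: cos_lip|exact: sin_lip].
Qed.

Lemma sum_itv_split (V : nmodType) (N : nat) (S : {fset nat}) (F : nat -> V) :
  (forall n : nat, n \in S -> (2 <= n <= N)%N) ->
  \sum_(1 <= n < N.+1) F n =
  \sum_(n <- S) F n + \sum_(1 <= n < N.+1 | n \notin S) F n.
Proof.
move=> S_itv; rewrite (bigID (fun n => n \in S))/=; congr +%R.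
rewrite -big_filter; apply: perm_big; apply: uniq_perm.
- by rewrite filter_uniq// iota_uniq.
- exact: fset_uniq.
- move=> n; rewrite mem_filter mem_index_iota ltnS.
  by apply/andP/idP => [[]//|nS]; have /andP[n2 ->] := S_itv n nS;
    rewrite nS (ltnW n2).
Qed.

(** Here [u] is [t^2] and [E] is [exp (t^2 / 2)]. The moment bounds carry [u^2], which cancels the
    inverse powers of [u] and makes the estimate uniform near 0; the remaining powers of [u] are
    absorbed into [E^2 = exp (t^2)]. *)
Lemma clt_constants (R : realFieldType) (u e E : R) : 0 < u -> 0 < e ->
  e <= 1 -> 1 <= E -> u <= 2 * E -> u ^+ 2 <= 16 * E ->
  2 * (2 * u * e + e) +
  2 * ((4 * u * e + E * u * e / 4) +
       E * ((4 * u * e)^-1 + 3 / u ^+ 2) * (6 * u ^+ 2 * e ^+ 2) +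
       (4 / e + E) * (4 * u ^+ 2 * e ^+ 4)) <= 1000 * (E ^+ 2 * e).
Proof.
move=> u0 e0 e1 E1 uE u2E.
have -> : E * ((4 * u * e)^-1 + 3 / u ^+ 2) * (6 * u ^+ 2 * e ^+ 2) =
  e * (3 / 2 * (E * u) + 18 * (E * e)) by field; rewrite !gt_eqF.
have -> : (4 / e + E) * (4 * u ^+ 2 * e ^+ 4) =
  e * (16 * (u ^+ 2 * e ^+ 2) + 4 * (E * u ^+ 2 * e ^+ 3))
  by field; rewrite gt_eqF.
have E2 : E <= E ^+ 2 by rewrite expr2 ler_peMr//; lra.
have ee2 : e ^+ 2 <= 1 by rewrite exprn_ile1// ltW.
have ee3 : e ^+ 3 <= 1 by rewrite exprn_ile1// ltW.
have k1 : E * u <= 2 * E ^+ 2.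
  by rewrite (_ : 2 * _ = E * (2 * E)); [rewrite ler_wpM2l//; lra|ring].
have k2 : E * e <= E by rewrite ler_piMr//; lra.
have u2 := sqr_ge0 u.
have k3 : u ^+ 2 * e ^+ 2 <= 16 * E by apply: le_trans u2E; rewrite ler_piMr.
have k4 : E * u ^+ 2 * e ^+ 3 <= 16 * E ^+ 2.
  apply: (@le_trans _ _ (E * u ^+ 2)).
    by rewrite ler_piMr// mulr_ge0//; lra.
  by rewrite (_ : 16 * _ = E * (16 * E)); [rewrite ler_wpM2l//; lra|ring].
have -> : 2 * (2 * u * e + e) + 2 * ((4 * u * e + E * u * e / 4) +
    e * (3 / 2 * (E * u) + 18 * (E * e)) +
    e * (16 * (u ^+ 2 * e ^+ 2) + 4 * (E * u ^+ 2 * e ^+ 3))) =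
  (4 * u + 2 + 2 * (4 * u + (E * u) / 4 + (3 / 2 * (E * u) + 18 * (E * e)) +
    (16 * (u ^+ 2 * e ^+ 2) + 4 * (E * u ^+ 2 * e ^+ 3)))) * e by field.
rewrite [leRHS]mulrA ler_pM2r//.
move: E2 k1 k2 k3 k4 E1 uE; set F := E ^+ 2; set a := E * u; set b := E * e.
set c := u ^+ 2 * _; set g := E * u ^+ 2 * _.
(* With the products as atoms the claim is linear. The listed bounds give the factor 709; 1000 is a
   round number above it. *)
by clearbody F a b c g; clear u2E u2 ee2 ee3; lra.
Qed.

(** * The estimate for coefficients normalised to [V = 1] *)

Section normalised.
Context {R : realType} {d : measure_display} {T : measurableType d}.
Variables (P : probability T R) (f : nat -> T -> R[i]).
Hypothesis sf : steinhaus P f.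
Variables (N : nat) (S : {fset nat}) (b : nat -> R[i]).
Hypothesis S_itv : forall n : nat, n \in S -> (2 <= n <= N)%N.
Variable e : R.
Hypotheses (e0 : 0 < e) (e1 : e <= 1).
Hypothesis H0 : \sum_(1 <= n < N.+1) cabs (b n) ^+ 2 = 1.
Hypothesis H1 : \sum_(1 <= n < N.+1 | n \notin S) cabs (b n) ^+ 2 <= e ^+ 2.
Hypothesis H2 : cabs (\sum_(m1 <- S) \sum_(m2 <- S) \sum_(n1 <- S)
        \sum_(n2 <- S | [&& (m1 * m2 == n1 * n2)%N, m1 != n1, m2 != n2,
                            max_pdiv m1 == max_pdiv n1
                          & max_pdiv m2 == max_pdiv n2])
          b m1 * b m2 * ((b n1 * b n2)^*)%C) <= e ^+ 2.
Hypothesis H3 : cabs (\sum_(m1 <- S) \sum_(m2 <- S) \sum_(n1 <- S)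
        \sum_(n2 <- S | [&& (m1 * m2 == n1 * n2)%N,
                            max_pdiv m1 == max_pdiv n1,
                            max_pdiv n1 == max_pdiv m2
                          & max_pdiv m2 == max_pdiv n2])
          b m1 * b m2 * ((b n1 * b n2)^*)%C) <= e ^+ 4.
Variables t1 t2 : R.

Local Notation cE := (cexpectation P).
Local Notation s := ((t1 ^+ 2 + t2 ^+ 2) / 2).
Local Notation c := (cterm f N b).
Local Notation x := (xblock f N S b t1 t2).

Definition phase (Z : R[i]) : R := t1 * complex.Re Z + t2 * complex.Im Z.

Lemma phaseD (Z1 Z2 : R[i]) : phase (Z1 + Z2) = phase Z1 + phase Z2.
Proof. by case: Z1 Z2 => [a1 b1] [a2 b2]; rewrite /phase/=; ring. Qed.

Lemma phase_le (Z : R[i]) : phase Z ^+ 2 <= 2 * s * cabs Z ^+ 2.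
Proof.
rewrite sqr_cabs /phase; case: Z => a u /=.
rewrite -subr_ge0 (_ : _ - _ = (t1 * u - t2 * a) ^+ 2) ?sqr_ge0//.
by field.
Qed.

Lemma bmeas_phase (F : T -> R[i]) : cbmeas F -> bmeas (fun w => phase (F w)).
Proof.
by move=> [bF cF]; apply: bmeasD; apply: bmeasM => //; exact: bmeas_cst.
Qed.

Lemma sum_zblock w : \sum_(j < N.+1) zblock f N S b j w = \sum_(n <- S) c n w.
Proof.
under eq_bigr do rewrite zblockE.
rewrite exchange_big; apply: eq_big_seq => n nS /=.
have h : \sum_(j < N.+1) (max_pdiv n == j)%:R = 1 :> R[i].
  rewrite -[RHS](sum_indicator (R := R) S_itv (fun=> true) nS).
  by apply: eq_bigr => j _; rewrite mul1r.
by rewrite -mulr_suml h mul1r.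
Qed.

Lemma phase_zblock w : phase (\sum_(n <- S) c n w) = \sum_(j < N.+1) x w j.
Proof.
rewrite -sum_zblock /phase !raddf_sum !mulr_sumr -big_split/=.
by apply: eq_bigr.
Qed.

Let bsum (r : seq nat) (A : pred nat) :
  cbmeas (fun w => \sum_(n <- r | A n) c n w).
Proof. by apply: cbmeas_sum => n _; exact: (cbmeas_cterm sf). Qed.

(** The integers outside [S] contribute a variable of second moment at most [e^2]. Since [expi] is
    Lipschitz, a first moment of its phase would suffice; the weight [e] converts it into that
    second moment. *)
Lemma truncation :
  cabs (cE (fun w => expi (phase (\sum_(1 <= n < N.+1) c n w)) -
                     expi (phase (\sum_(n <- S) c n w)))) <=
  2 * (2 * s * e + e).
Proof.
pose D w := \sum_(1 <= n < N.+1 | n \notin S) c n w.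
have bD : cbmeas D by exact: bsum.
have bD2 := bmeas_cabs2 bD.
have ED : rexp P (fun w => cabs (D w) ^+ 2) <= e ^+ 2.
  apply: le_trans H1.
  rewrite -[leRHS]big_filter -(parseval sf (N := N) b).
  - by under eq_fun do rewrite /D -big_filter.
  - by rewrite filter_uniq// iota_uniq.
  - move=> n; rewrite mem_filter mem_index_iota => /andP[_ nN].
    by apply: smooth_itv.
have s0 : 0 <= s by rewrite divr_ge0// addr_ge0// sqr_ge0.
have bB : bmeas (fun w => (2 * s / e) * cabs (D w) ^+ 2).
  by apply: bmeasM => //; exact: bmeas_cst.
apply: (@le_trans _ _ (2 * rexp P (fun w =>
    (2 * s / e) * cabs (D w) ^+ 2 + e))).
  apply: ler_cabs_cexp.
  - apply: cbmeasD.
      by apply: cbmeas_expi; have [] := bmeas_phase (bsum (index_iota 1 N.+1) xpredT).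
    have [m1 _] := bmeas_phase (bsum S xpredT).
    have [bE cE'] := cbmeas_expi m1.
    by split; [under eq_fun do rewrite raddfN|under eq_fun do rewrite raddfN];
      exact: bmeasN.
  - by apply: bmeasD => //; exact: bmeas_cst.
  - move=> w; rewrite (sum_itv_split _ S_itv) phaseD -/(D w).
    apply: (le_trans (expi_lip _ _)); rewrite addrAC subrr add0r.
    set u := phase (D w); have hu : u ^+ 2 <= 2 * s * cabs (D w) ^+ 2 := phase_le _.
    have : 2 * `|u| <= u ^+ 2 / e + e.
      have : 0 <= (`|u| - e) ^+ 2 / e by rewrite divr_ge0 ?sqr_ge0// ltW.
      rewrite (_ : _ / e = u ^+ 2 / e + e - 2 * `|u|); first by lra.
      by rewrite sqrrB real_normK ?num_real//; field; rewrite gt_eqF.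
    have : u ^+ 2 / e <= 2 * s / e * cabs (D w) ^+ 2.
      by rewrite [leRHS]mulrAC ler_pM2r// invr_gt0.
    by lra.
rewrite ler_pM2l// rexpD//; last exact: bmeas_cst.
rewrite rexp_cst rexpZ// lerD2r.
have h : 0 <= 2 * s / e by apply: divr_ge0; [exact: mulr_ge0|exact: ltW].
apply: (le_trans (ler_wpM2l h ED)).
by rewrite le_eqVlt; apply/orP; left; apply/eqP; field; rewrite gt_eqF.
Qed.

(** The factor 6 is [2 * 3]: the deviation of the sum of [|z|^2] gives [e^2 + e^4], the sum of [z^2]
    gives [e^4], and [e^4 <= e^2]. *)
Lemma rexp_qvar_dev :
  rexp P (fun w => (qvar (x w) N.+1 - s) ^+ 2) <= 6 * s ^+ 2 * e ^+ 2.
Proof.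
pose y w := \sum_(j < N.+1) cabs (zblock f N S b j w) ^+ 2.
pose B w := cabs (\sum_(j < N.+1) zblock f N S b j w ^+ 2) ^+ 2.
have bQ : bmeas (fun w => (qvar (x w) N.+1 - s) ^+ 2).
  by apply: bmeasX; apply: bmeasB; [exact: (bmeas_qvar sf)|exact: bmeas_cst].
have by_ : bmeas (fun w => (y w - 1) ^+ 2).
  by apply: bmeasX; apply: bmeasB; [exact: (bmeas_znorm2 sf)|exact: bmeas_cst].
have bB : bmeas B := bmeas_zsqr sf N S b.
have byB : bmeas (fun w => (y w - 1) ^+ 2 + B w) by exact: bmeasD.
have := ler_rexp P bQ (bmeasM (bmeas_cst (2 * s ^+ 2)) byB)
  (qvar_dev f N S b t1 t2).
rewrite rexpZ// rexpD// => h; apply: (le_trans h).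
have := rexp_zsqr sf S_itv H3; rewrite -/B => hB.
have v1 : 1 - e ^+ 2 <= \sum_(n <- S) cabs (b n) ^+ 2.
  have := sum_itv_split (fun n => cabs (b n) ^+ 2) S_itv.
  by rewrite H0; have := H1; lra.
have v2 : \sum_(n <- S) cabs (b n) ^+ 2 <= 1.
  have := sum_itv_split (fun n => cabs (b n) ^+ 2) S_itv; rewrite H0 => ->.
  by rewrite lerDl sumr_ge0// => n _; rewrite sqr_ge0.
have := rexp_znorm2_dev sf S_itv H2 v1 v2; rewrite -/(y _) => hy.
have he : e ^+ 4 <= e ^+ 2.
  by rewrite -[4%N]/(2 + 2)%N exprD ler_piMr ?sqr_ge0// exprn_ile1// ltW.
have hs := sqr_ge0 s.
have -> : 6 * s ^+ 2 * e ^+ 2 = 2 * s ^+ 2 * (3 * e ^+ 2) by ring.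
rewrite ler_wpM2l//; first by rewrite mulr_ge0.
by lra.
Qed.

Lemma rexp_qquart :
  rexp P (fun w => qquart (x w) N.+1) <= 4 * s ^+ 2 * e ^+ 4.
Proof.
have bz : bmeas _ := bmeas_znorm4 sf N S b.
have := ler_rexp P (bmeas_qquart sf N S b t1 t2 N.+1)
  (bmeasM (bmeas_cst (4 * s ^+ 2)) bz) (qquart_le f N S b t1 t2).
rewrite rexpZ// => h; apply: (le_trans h).
apply: ler_wpM2l; last exact: (rexp_znorm4 sf S_itv H3).
by apply: mulr_ge0 => //; exact: sqr_ge0.
Qed.

(** The stopped product has mean 1, so [exp (- s / 2)] is the mean of its multiple; the two
    integrands are then compared pointwise. *)
Lemma martingale_clt : 0 < s ->
  cabs (cE (fun w => expi (phase (\sum_(n <- S) c n w))) -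
        (expR (- s / 2))%:C%C) <=
  2 * ((4 * s * e + expR (s / 2) * s * e / 4) +
       expR (s / 2) * ((4 * s * e)^-1 + 3 / s ^+ 2) * (6 * s ^+ 2 * e ^+ 2) +
       (4 / e + expR (s / 2)) * (4 * s ^+ 2 * e ^+ 4)).
Proof.
move=> s0.
have bst : cbmeas (fun w => stopped s (x w) N.+1).
  exact: (others_cbmeas sf (others_stopped f N S b t1 t2 (leqnn _))).
have bL : cbmeas (fun w => expi (phase (\sum_(n <- S) c n w))).
  by apply: cbmeas_expi; have [] := bmeas_phase (bsum S xpredT).
have bstE : cbmeas (fun w => - (expR (- s / 2))%:C%C * stopped s (x w) N.+1).
  exact: (cbmeasM (cbmeas_cst _)).
have -> : cE (fun w => expi (phase (\sum_(n <- S) c n w))) -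
        (expR (- s / 2))%:C%C =
    cE (fun w => expi (phase (\sum_(n <- S) c n w)) +
        (- (expR (- s / 2))%:C%C * stopped s (x w) N.+1)).
  by rewrite cexpD// cexpZ// (cexp_stopped sf b S_itv) mulr1.
have bQ : bmeas (fun w => (qvar (x w) N.+1 - s) ^+ 2).
  by apply: bmeasX; apply: bmeasB; [exact: (bmeas_qvar sf)|exact: bmeas_cst].
have bW : bmeas (fun w => qquart (x w) N.+1) := bmeas_qquart sf N S b t1 t2 N.+1.
set al := 4 * s * e + _; set be := expR (s / 2) * _; set ga := _ + expR (s / 2).
have be0 : 0 <= be.
  apply: mulr_ge0; first exact: expR_ge0.
  apply: addr_ge0; last by apply: divr_ge0 => //; exact: sqr_ge0.
  by rewrite invr_ge0; apply/ltW/mulr_gt0 => //; exact: mulr_gt0.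
have ga0 : 0 <= ga by rewrite addr_ge0 ?expR_ge0// divr_ge0// ltW.
have bb : bmeas (fun w => be * (qvar (x w) N.+1 - s) ^+ 2).
  exact: (bmeasM (bmeas_cst _)).
have bg : bmeas (fun w => ga * qquart (x w) N.+1).
  exact: (bmeasM (bmeas_cst _)).
have bab : bmeas (fun w => al + be * (qvar (x w) N.+1 - s) ^+ 2).
  exact: (bmeasD (bmeas_cst _)).
apply: (@le_trans _ _ (2 * rexp P (fun w =>
    al + be * (qvar (x w) N.+1 - s) ^+ 2 + ga * qquart (x w) N.+1))).
  apply: ler_cabs_cexp; first exact: cbmeasD.
    exact: bmeasD.
  move=> w; rewrite phase_zblock mulNr mulrC.
  exact: stopped_approx.
rewrite ler_pM2l// rexpD// rexpD//; last exact: bmeas_cst.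
rewrite rexp_cst !rexpZ//; apply: lerD.
  by rewrite lerD2l; exact: ler_wpM2l be0 _ _ rexp_qvar_dev.
exact: ler_wpM2l ga0 _ _ rexp_qquart.
Qed.

Lemma normalised_clt :
  cabs (cE (fun w => expi (phase (\sum_(1 <= n < N.+1) c n w))) -
        (expR (- s / 2))%:C%C) <= 1000 * (expR s * e).
Proof.
have s0 : 0 <= s by rewrite divr_ge0// addr_ge0// sqr_ge0.
(* The martingale estimate divides by [s]. For [s = 0] both [t1] and [t2] vanish, and the difference
   is [1 - 1]. *)
have [sE|sn0] := eqVneq s 0.
  have t0 : t1 ^+ 2 + t2 ^+ 2 = 0 by lra.
  have t10 : t1 = 0.
    apply/eqP; rewrite -sqrf_eq0 eq_le sqr_ge0 andbT.
    by have := sqr_ge0 t2; lra.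
  have t20 : t2 = 0.
    apply/eqP; rewrite -sqrf_eq0 eq_le sqr_ge0 andbT.
    by have := sqr_ge0 t1; lra.
  rewrite (@eq_cexp _ _ _ _ _ (fun=> 1)); last first.
    by move=> w; rewrite /phase t10 t20 !mul0r addr0 expi0.
  rewrite cexp_cst sE oppr0 mul0r !expR0 subrr /= expr0n/= addr0 sqrtr0.
  by apply: mulr_ge0; [exact: ler0n|rewrite mul1r ltW].
have sp : 0 < s by rewrite lt_def sn0.
have h1 := truncation; have h2 := martingale_clt sp.
have bL : cbmeas (fun w => expi (phase (\sum_(n <- S) c n w))).
  by apply: cbmeas_expi; have [] := bmeas_phase (bsum S xpredT).
have bL' : cbmeas (fun w => expi (phase (\sum_(1 <= n < N.+1) c n w))).
  by apply: cbmeas_expi; have [] := bmeas_phase (bsum (index_iota 1 N.+1) xpredT).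
have bNL : cbmeas (fun w => - expi (phase (\sum_(n <- S) c n w))).
  by case: bL => b1 b2; split; under eq_fun do rewrite raddfN; exact: bmeasN.
rewrite cexpD// cexpN// in h1.
set z1 := cE _ in h1 *; set z2 := cE _ in h1 h2; set ez := (expR _)%:C%C in h2 *.
have -> : z1 - ez = (z1 - z2) + (z2 - ez) by ring.
apply: (le_trans (ler_cabsD _ _)).
apply: (le_trans (lerD h1 h2)).
set E := expR (s / 2).
have EE : expR s = E ^+ 2.
  by rewrite /E -expRM_natr; congr expR; field.
have E1 : 1 <= E by rewrite /E -[leLHS]expR0 ler_expR divr_ge0.
have sE : s <= 2 * E by have := expR_ge1Dx (s / 2); rewrite -/E; lra.
(* This is the square of [s <= 4 * exp (s / 4)]. *)
have s2E : s ^+ 2 <= 16 * E.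
  have -> : E = expR (s / 4) ^+ 2 by rewrite /E -expRM_natr; congr expR; field.
  have h := expR_ge1Dx (s / 4).
  rewrite (_ : 16 * _ = (4 * expR (s / 4)) ^+ 2); last by ring.
  by rewrite lerXn2r ?nnegrE ?mulr_ge0 ?expR_ge0//; lra.
rewrite EE; exact: clt_constants.
Qed.

End normalised.

(** * From the unimodular version back to [f] *)

Section almost_sure.
Context {R : realType} {d : measure_display} {T : measurableType d}.
Variables (P : probability T R) (f : nat -> T -> R[i]).
Hypothesis sf : steinhaus P f.

(** Measurability without boundedness, since [f] itself may leave the circle on a null set. *)
Definition cmeas (F : T -> R[i]) :=
  measurable_fun [set: T] (fun w => complex.Re (F w)) /\
  measurable_fun [set: T] (fun w => complex.Im (F w)).

Lemma cmeasM (F G : T -> R[i]) :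
  cmeas F -> cmeas G -> cmeas (fun w => F w * G w).
Proof.
move=> [rF iF] [rG iG]; split.
- under eq_fun do rewrite Re_mulc.
  by apply: measurable_funB; exact: measurable_funM.
- under eq_fun do rewrite Im_mulc.
  by apply: measurable_funD; exact: measurable_funM.
Qed.

Lemma cmeas_cst (c : R[i]) : cmeas (fun=> c).
Proof. by split; exact: measurable_cst. Qed.

Lemma cmeas_sum (r : seq nat) (F : nat -> T -> R[i]) :
  (forall n, n \in r -> cmeas (F n)) -> cmeas (fun w => \sum_(n <- r) F n w).
Proof.
elim: r => [|n r IH] mF.
  by under eq_fun do rewrite big_nil; exact: cmeas_cst.
have [rF iF] : cmeas (F n) by apply: mF; rewrite mem_head.
have [rS iS] : cmeas (fun w => \sum_(m <- r) F m w).
  by apply: IH => m mr; apply: mF; rewrite in_cons mr orbT.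
by split; under eq_fun do rewrite big_cons raddfD; exact: measurable_funD.
Qed.

Lemma cmeas_steinhaus n : (0 < n)%N -> cmeas (f n).
Proof.
elim/ltn_ind: n => n IH n0; have [n1|n1] := leqP n 1%N.
  have -> : n = 1%N by apply/eqP; rewrite eqn_leq n1.
  rewrite (_ : f 1%N = fun=> 1); first exact: cmeas_cst.
  by apply/funext => w; exact: steinhaus1 sf w.
have pp := pdiv_prime n1; have [m nE] := dvdnP (pdiv_dvd n).
have p0 := prime_gt0 pp.
have m0 : (0 < m)%N by move: n0; rewrite {1}nE muln_gt0 => /andP[].
have mn : (m < n)%N by rewrite {1}nE ltn_Pmulr// prime_gt1.
rewrite (_ : f n = fun w => f m w * f (pdiv n) w); last first.
  by apply/funext => w; rewrite -(steinhausM sf)// -nE.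
apply: cmeasM; first exact: IH.
have mp := steinhaus_measurable sf pp.
by split; [exact: (measurableT_comp measurable_fst mp)|
  exact: (measurableT_comp measurable_snd mp)].
Qed.

(** The circle is a measurable subset of the plane which the uniform angle hits always, so [f p]
    lies on it with probability 1; there clipping changes nothing. *)
Lemma steinhaus_unimodular p : prime p ->
  \forall w \ae P, cf f p w = f p w.
Proof.
move=> pp; pose A := [set y : R * R | y.1 ^+ 2 + y.2 ^+ 2 = 1].
have mA : measurable A.
  have mg : measurable_fun [set: R * R] (fun y : R * R => y.1 ^+ 2 + y.2 ^+ 2).
    by apply: measurable_funD; apply: measurable_funX.
  have := mg measurableT [set 1] (measurable_set1 1).
  by rewrite setTI.
pose B := [set w | A (plane (f p w))].
have mB : measurable B := measurable_steinhaus_preimage sf pp mA.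
have PB : P B = 1%E.
  rewrite /B (steinhaus_uniform sf pp mA).
  rewrite (_ : [set theta | _] = setT) ?probability_setT//.
  by apply/seteqP; split => // x _; exact: cos2Dsin2.
exists (~` B); split.
- exact: measurableC.
- by rewrite -[LHS]/(P (~` B)) probability_setC// PB subee.
- move=> w /= h wB; apply: h; apply: clip_plane; exact: wB.
Qed.

Lemma cexp_ae (F G : T -> R[i]) : cmeas F -> cmeas G ->
  (\forall w \ae P, F w = G w) -> cexpectation P F = cexpectation P G.
Proof.
move=> [rF iF] [rG iG] FG; rewrite !cexpE !rexpE /Rintegral.
congr Complex; congr fine; apply: ae_eq_integral => //.
- exact/measurable_EFinP.
- exact/measurable_EFinP.
- by apply: filterS FG => w /= -> _.
- exact/measurable_EFinP.
- exact/measurable_EFinP.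
- by apply: filterS FG => w /= -> _.
Qed.

Lemma cmeas_expi_phase (t1 t2 : R) (F : T -> R[i]) : cmeas F ->
  cmeas (fun w => expi (phase t1 t2 (F w))).
Proof.
move=> [rF iF].
have mp : measurable_fun [set: T] (fun w => phase t1 t2 (F w)).
  by apply: measurable_funD; apply: measurable_funM => //; exact: measurable_cst.
by have [[m1 _] [m2 _]] := cbmeas_expi mp; split.
Qed.

Lemma cexp_unimodular_version (N : nat) (b : nat -> R[i]) (t1 t2 : R) :
  cexpectation P (fun w =>
    expi (phase t1 t2 (\sum_(1 <= n < N.+1) b n * f n w))) =
  cexpectation P (fun w =>
    expi (phase t1 t2 (\sum_(1 <= n < N.+1) cterm f N b n w))).
Proof.
apply: cexp_ae.
- apply: cmeas_expi_phase; apply: cmeas_sum => n.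
  rewrite mem_index_iota => /andP[n0 _].
  by apply: cmeasM; [exact: cmeas_cst|exact: cmeas_steinhaus].
- apply: cmeas_expi_phase; apply: cmeas_sum => n _.
  by have [[m1 _] [m2 _]] := cbmeas_cterm sf N b n; split.
(* The exceptional null sets, one for each prime, have a null union. *)
- have : \forall w \ae P, forall q, prime q -> cf f q w = f q w.
    apply: ae_foralln => q; have [qp|nq] := boolP (prime q).
      by apply: filterS (steinhaus_unimodular qp) => w.
    by apply: aeW.
  apply: filterS => w fw; congr (expi (phase _ _ _)).
  apply: eq_big_nat => n nN; rewrite /cterm (ft_eq sf)// => q qp _.
  exact: fw.
Qed.

End almost_sure.

Lemma quad_scale (R : realType) (S : {fset nat}) (a : nat -> R[i]) (k : R)
    (A : nat -> nat -> nat -> nat -> bool) : 0 <= k ->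
  cabs (\sum_(m1 <- S) \sum_(m2 <- S) \sum_(n1 <- S)
    \sum_(n2 <- S | A m1 m2 n1 n2)
      (k%:C%C * a m1) * (k%:C%C * a m2) *
      ((k%:C%C * a n1 * (k%:C%C * a n2))^*)%C) =
  k ^+ 4 * cabs (\sum_(m1 <- S) \sum_(m2 <- S) \sum_(n1 <- S)
    \sum_(n2 <- S | A m1 m2 n1 n2) a m1 * a m2 * ((a n1 * a n2)^*)%C).
Proof.
move=> k0; rewrite -[k ^+ 4]ger0_norm ?exprn_ge0// -cabs_real -cabsM.
congr cabs; rewrite rmorphXn/=.
rewrite mulr_sumr; apply: eq_bigr => m1 _.
rewrite mulr_sumr; apply: eq_bigr => m2 _.
rewrite mulr_sumr; apply: eq_bigr => n1 _.
rewrite mulr_sumr; apply: eq_bigr => n2 _.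
by rewrite !conjcM !conjc_real; ring.
Qed.

Theorem theorem3p1 (R : realType) :
  exists C : R, 0 < C /\
  forall (d : measure_display) (T : measurableType d) (P : probability T R)
    (f : nat -> T -> R[i]) (N : nat) (a : nat -> R[i]) (S : {fset nat})
    (eps : R),
  let V : R := \sum_(1 <= n < N.+1) cabs (a n) ^+ 2 in
  let Z : T -> R[i] := fun w =>
    ((Num.sqrt V)^-1)%:C%C * \sum_(1 <= n < N.+1) a n * f n w in
  steinhaus P f ->
  0 < V ->
  (forall n : nat, n \in S -> (2 <= n <= N)%N) ->
  0 < eps -> eps <= 1 ->
  \sum_(1 <= n < N.+1 | n \notin S) cabs (a n) ^+ 2 <= eps ^+ 2 * V ->
  cabs (\sum_(m1 <- S) \sum_(m2 <- S) \sum_(n1 <- S)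
        \sum_(n2 <- S | [&& (m1 * m2 == n1 * n2)%N, m1 != n1, m2 != n2,
                            max_pdiv m1 == max_pdiv n1
                          & max_pdiv m2 == max_pdiv n2])
          a m1 * a m2 * ((a n1 * a n2)^*)%C) <= eps ^+ 2 * V ^+ 2 ->
  cabs (\sum_(m1 <- S) \sum_(m2 <- S) \sum_(n1 <- S)
        \sum_(n2 <- S | [&& (m1 * m2 == n1 * n2)%N,
                            max_pdiv m1 == max_pdiv n1,
                            max_pdiv n1 == max_pdiv m2
                          & max_pdiv m2 == max_pdiv n2])
          a m1 * a m2 * ((a n1 * a n2)^*)%C) <= eps ^+ 4 * V ^+ 2 ->
  forall t1 t2 : R,
  let tsq : R := (t1 ^+ 2 + t2 ^+ 2) / 2 in
  cabs (cexpectation P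
          (fun w => expi (t1 * complex.Re (Z w) + t2 * complex.Im (Z w)))
        - (expR (- tsq / 2))%:C%C)
    <= C * (expR tsq * eps).
Proof.
exists 1000; split; first by rewrite ltr0n.
move=> d T P f N a S eps V Z sf V0 S_itv e0 e1 H1 H2 H3 t1 t2; cbv zeta.
(* Scaling the coefficients by [k] reduces to [V = 1]: the mass outside [S] is of degree 2 in them
   and the quadruple sums of degree 4, matching the powers [V] and [V^2] in the hypotheses. *)
pose k := (Num.sqrt V)^-1.
have k0 : 0 <= k by rewrite invr_ge0 sqrtr_ge0.
have k2 : k ^+ 2 = V^-1 by rewrite exprVn sqr_sqrtr// ltW.
have k4 : k ^+ 4 = V ^- 2 by rewrite -[4%N]/(2 * 2)%N exprM k2 exprVn.
pose b n := k%:C%C * a n.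
have bE n : cabs (b n) ^+ 2 = V^-1 * cabs (a n) ^+ 2.
  by rewrite /b cabsM cabs_real ger0_norm// exprMn k2.
have Vn0 : V != 0 by rewrite gt_eqF.
have V20 : 0 < V ^+ 2 by rewrite exprn_gt0.
have N0 : \sum_(1 <= n < N.+1) cabs (b n) ^+ 2 = 1.
  by under eq_bigr do rewrite bE; rewrite -mulr_sumr mulVf.
have N1 : \sum_(1 <= n < N.+1 | n \notin S) cabs (b n) ^+ 2 <= eps ^+ 2.
  under eq_bigr do rewrite bE.
  by rewrite -mulr_sumr mulrC ler_pdivrMr.
have scale (e : R) (q : R) : q <= e * V ^+ 2 -> k ^+ 4 * q <= e.
  by move=> h; rewrite k4 mulrC ler_pdivrMr.
have N2 := scale _ _ H2; rewrite -quad_scale// in N2.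
have N3 := scale _ _ H3; rewrite -quad_scale// in N3.
have := normalised_clt sf S_itv e0 e1 N0 N1 N2 N3 t1 t2.
rewrite -(cexp_unimodular_version sf).
rewrite (@eq_cexp _ _ _ _ _
  (fun w => expi (t1 * complex.Re (Z w) + t2 * complex.Im (Z w))))//.
move=> w; congr (expi (phase _ _ _)).
by rewrite /Z mulr_sumr; apply: eq_bigr => n _; rewrite mulrA.
Qed.
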